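(* Let $k\ge3$ and $j\in\mathbb{N}$. The Fourier coefficients (in $q$) of $f_{k,j}(\tau)+\frac{B_j}{2j}$ are integers.
   Context: $\tau\in\mathbb{H}$, $q=e^{2\pi i\tau}$, $\zeta=e^{2\pi iz}$, $(a)_n=\prod_{m=0}^{n-1}(1-aq^m)$, $B_j$ Bernoulli numbers. For $k\ge3$, $FG_k(\zeta,q)=\sum_{n_{k-1}\geq\dots\geq n_1\geq 1}\frac{q^{n_1^2+\dots+n_{k-1}^2}}{(q)_{n_{k-1}-n_{k-2}}\cdots(q)_{n_2-n_1}(\zeta q)_{n_1}(\zeta^{-1}q)_{n_1}}$, $\theta_{a,b}(\tau)=\sum_{n\in\mathbb{Z}}(-1)^nq^{(bn^2+an)/2}$, and $f_{k,j}$ ($j\in\mathbb{N}$) are defined by $$FG_k(\zeta,q)+\frac{\theta_{1,2k-1}(\tau)}{(q)_\infty}=\frac{\sin(\pi z)}{\pi z(q)_\infty}\exp\left(2\sum_{j\ge1}f_{k,j}(\tau)\frac{(2\pi iz)^j}{j!}\right).$$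
   Formalization: The constant Fourier coefficient for j = 1 is excepted: since f_{k,1} = 0 by the symmetry z → −z, it equals B_1/2 = −1/4 and is not an integer; all other Fourier coefficients are asserted to be integers. *)

(* Defs.v *)
From mathcomp Require Export all_boot all_order all_algebra.
From mathcomp Require Export all_classical all_reals all_analysis.
From mathcomp Require Export complex.
Export numFieldNormedType.Exports.
Import Order.TTheory GRing.Theory Num.Theory.

Set Implicit Arguments.
Unset Strict Implicit.
Unset Printing Implicit Defensive.

Local Open Scope classical_set_scope.
Local Open Scope ring_scope.

(* The library puts the norm topology on every numClosedFieldType, but does not
   find it on the bare type R[i]. *)
Definition C (R : realType) : numClosedFieldType := R[i].

Definition cexp (R : realType) (z : C R) : C R :=
  Complex (expR (complex.Re z) * cos (complex.Im z))
          (expR (complex.Re z) * sin (complex.Im z)).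

Definition cpi (R : realType) : C R := Complex pi 0.
Definition cI (R : realType) : C R := Complex 0 1.

Definition csin (R : realType) (z : C R) : C R :=
  (cexp (cI R * z) - cexp (- (cI R * z))) / (2 * cI R).

(* e2pi tau is q and e2pi z is zeta. *)
Definition e2pi (R : realType) (z : C R) : C R := cexp (2 * cpi R * cI R * z).

Definition upper_half_plane (R : realType) : set (C R) :=
  [set tau | 0 < complex.Im tau].

(* The list B_0, ..., B_n, from \sum_(i <= n) 'C(n + 1, i) B_i = 0 for n > 0;
   in particular B_1 = - 1 / 2. *)
Fixpoint bernoulli_seq (n : nat) : seq rat :=
  if n is m.+1 then
    let s := bernoulli_seq m in
    rcons s (- (\sum_(i < m.+1) 'C(m.+2, i)%:R * s`_i) / m.+2%:R)
  else [:: 1].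

Definition bernoulli (n : nat) : rat := (bernoulli_seq n)`_n.

Definition qpoch (R : realType) (a q : C R) (n : nat) : C R :=
  \prod_(m < n) (1 - a * q ^+ m).

Definition qpoch_inf (R : realType) (a q : C R) : C R := limn (qpoch a q).

(* The summand of FG at s = [:: n_1; ...; n_(k-1)]. *)
Definition FG_term (R : realType) (zeta q : C R) (s : seq nat) : C R :=
  q ^+ (\sum_(n <- s) n ^ 2)%N /
  ((\prod_(i < (size s).-1) qpoch q q (nth 0%N s i.+1 - nth 0%N s i)%N) *
   qpoch (zeta * q) q (head 0%N s) * qpoch (zeta^-1 * q) q (head 0%N s)).

(* The N-th partial sum is over all N >= n_(k-1) >= ... >= n_1 >= 1. *)
Definition FG (R : realType) (k : nat) (zeta q : C R) : C R :=
  limn (fun N : nat =>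
    \sum_(t : (k.-1).-tuple 'I_N.+1 |
            let s := [seq val i | i <- t] in
            sorted leq s && (0 < head 0 s)%N)
      FG_term zeta q [seq val i | i <- t]).

Definition theta_term (R : realType) (a b : int) (tau : C R) (n : int) : C R :=
  (-1) ^ n * e2pi (tau * ((b * n ^ 2 + a * n)%:~R / 2)).

(* The sum over all of int: Posz n is n and Negz n is - (n + 1). *)
Definition theta (R : realType) (a b : int) (tau : C R) : C R :=
  limn (series (fun n : nat => theta_term a b tau (Posz n))) +
  limn (series (fun n : nat => theta_term a b tau (Negz n))).

(* f j is f_{k,j} for j >= 1; the value f 0 is irrelevant. For fixed tau the
   defining identity is between functions holomorphic near z = 0; it is asked
   on a punctured neighbourhood, where sin (pi z) / (pi z) needs no value at 0.
   S is the sum of the power series in the exponent. *)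
Definition is_FG_coefs (R : realType) (k : nat) (f : nat -> C R -> C R) : Prop :=
  forall tau : C R, upper_half_plane tau ->
  \forall z \near (0 : C R)^',
    exists2 S : C R,
      series (fun j : nat =>
        f j.+1 tau * (2 * cpi R * cI R * z) ^+ j.+1 / (j.+1)`!%:R) @ \oo --> S
    & FG k (e2pi z) (e2pi tau)
        + theta 1 (2 * k%:Z - 1) tau / qpoch_inf (e2pi tau) (e2pi tau)
      = csin (cpi R * z) / (cpi R * z * qpoch_inf (e2pi tau) (e2pi tau))
        * cexp (2 * S).

Definition fourier_expansion (R : realType) (g : C R -> C R) (c : nat -> C R) :
    Prop :=
  forall tau : C R, upper_half_plane tau ->
    series (fun n : nat => c n * e2pi tau ^+ n) @ \oo --> g tau.

(* Main.v *)
(* Put u = 2 pi i z and w = zeta + 1/zeta - 2 = e^u + e^(-u) - 2. Since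
   (1 - zeta q^m) (1 - q^m / zeta) = (1 - q^m)^2 - q^m w, the function
   (q)_oo FG_k is a power series in q with coefficients in Z[w], hence equals
   sum_l gam_l(q) w^l with gam_l in Z[[q]]. In powers of u, the coefficients
   of u^m / m! in w^l are even integers for m >= 1, so
   F = (q)_oo FG_k + theta = sum_m phi_m(q) u^m / m! with phi_m in 2 Z[[q]]
   for m >= 1. The hypothesis itself forces phi_0 = 1, so neither Bailey pairs
   nor the Andrews-Gordon identity are needed.
   As log ((e^u - 1) / u) = u + sum_(j >= 1) (B_j / j) u^j / j!, the hypothesis
   reads log F = sum_(j >= 1) psi_j u^j / j! with
   psi_j = 2 (f_j + B_j / (2 j)) + [j = 1] / 2, and comparing coefficients in
   F' = (log F)' F gives
   phi_(m+1) = sum_(i <= m) 'C(m, i) psi_(i+1) phi_(m-i),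
   which shows inductively that psi_j / 2 lies in Z[[q]].
   All comparisons in u are made between Taylor polynomials of finite order at
   u = 0, for fixed tau. *)
Require Import Defs.
From mathcomp Require Import zify ring lra.
Import Order.TTheory GRing.Theory Num.Theory.

Set Implicit Arguments.
Unset Strict Implicit.
Unset Printing Implicit Defensive.

Local Open Scope classical_set_scope.
Local Open Scope ring_scope.

(** * Modulus and convergence of complex sequences *)

(** The obstacle is uniformity. The outermost sum of FG_k is infinite, and rearranging it by powers
    of q and then by powers of w needs bounds independent of all summation indices. So [wq_series]
    carries, besides its polynomials in Z[w], a majorant depending on |q| alone, measured in a
    coefficient norm on the disc |w| <= [wrad] |q|. Bounds exp (a r / (1 - r)) on finite products
    keep these majorants independent of the indices, and the factor q^(n^2) pays for each sum. In u,
    the relation [taylor N f p] means f = p + O(u^N) on a punctured disc. Such expansions can be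
    added, multiplied and exponentiated, and they determine all coefficients below N; the truncated
    exponential [expP] satisfies F' = (log F)' F up to truncation. Finally, one coefficient sequence
    must serve all tau, whereas the hypothesis is exploited for one tau at a time. Hence the
    recurrence is solved by functions of q ([int_qseries]) that are chosen before tau. *)

Lemma eq_cvgn (T : topologicalType) (u v : nat -> T) (l : T) :
  u @ \oo --> l -> u =1 v -> v @ \oo --> l.
Proof. by move=> ul /funext <-. Qed.

Lemma squeeze0 (R : realType) (u v : nat -> R) :
  (forall n, 0 <= u n <= v n) -> v @ \oo --> 0 -> u @ \oo --> 0.
Proof.
move=> uv /cvgrPdist_lt h; apply/cvgrPdist_lt => e /h[N _ hN].
exists N => // n /hN /=; have /andP[u0 le_uv] := uv n.
rewrite !sub0r !normrN !ger0_norm// ?(le_trans u0)//.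
exact: le_lt_trans.
Qed.

Section ComplexModulus.
Variable R : realType.
Implicit Types (x y z l : C R) (u v : nat -> C R).

(** The norm of [C R] takes values in [C R], which is only partially ordered. Its real part is the
    modulus in [R], where a total order and real majorants are at hand. *)
Definition nm (z : C R) : R := complex.Re `|z|.

Lemma nmE z : `|z| = (Complex (nm z) 0 : C R).
Proof. by rewrite /nm normc_def. Qed.

Lemma nm_ge0 z : 0 <= nm z.
Proof. by have := normr_ge0 z; rewrite nmE lecE /= eqxx. Qed.

Lemma nmM x y : nm (x * y) = nm x * nm y.
Proof.
have := normrM x y; rewrite !nmE => /(congr1 (@complex.Re R)) /= ->.
by rewrite mul0r subr0.
Qed.

Lemma nmD x y : nm (x + y) <= nm x + nm y.
Proof. by have := ler_normD x y; rewrite !nmE lecE /= => /andP[]. Qed.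

Lemma nmN x : nm (- x) = nm x.
Proof. by rewrite /nm normrN. Qed.

Lemma nmB x y : nm (x - y) <= nm x + nm y.
Proof. by rewrite -(nmN y) nmD. Qed.

Lemma nmBC x y : nm (x - y) = nm (y - x).
Proof. by rewrite -nmN opprB. Qed.

Lemma nm_tri z x y : nm (x - y) <= nm (x - z) + nm (z - y).
Proof. by rewrite (le_trans _ (nmD _ _))// addrA subrK. Qed.

Lemma nm_real (r : R) : nm (Complex r 0) = `|r|.
Proof. by rewrite /nm normc_def /= expr0n /= addr0 sqrtr_sqr. Qed.

Lemma nm0 : nm 0 = 0.
Proof. by rewrite /nm normr0. Qed.

Lemma nm1 : nm 1 = 1.
Proof. by rewrite /nm normr1. Qed.

Lemma nm_eq0 z : (nm z == 0) = (z == 0).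
Proof.
apply/eqP/eqP => [h|->]; last exact: nm0.
by apply/normr0_eq0; rewrite nmE h.
Qed.

Lemma nm_gt0 z : (0 < nm z) = (z != 0).
Proof. by rewrite lt_def nm_eq0 nm_ge0 andbT. Qed.

Lemma nmX z n : nm (z ^+ n) = nm z ^+ n.
Proof. by elim: n => [|n ih]; rewrite ?expr0 ?nm1// !exprS nmM ih. Qed.

Lemma nmV z : nm z^-1 = (nm z)^-1.
Proof.
have [->|z0] := eqVneq z 0; first by rewrite invr0 nm0 invr0.
have nz0 : nm z != 0 by rewrite nm_eq0.
by apply: (mulfI nz0); rewrite -nmM !divff// nm1.
Qed.

Lemma nm_nat n : nm n%:R = n%:R.
Proof.
have -> : (n%:R : C R) = Complex n%:R 0.
  exact: esym (rmorph_nat (real_complex R) n).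
by rewrite nm_real normr_nat.
Qed.

Lemma nm_int (n : int) : nm n%:~R = `|n%:~R|.
Proof.
have -> : (n%:~R : C R) = Complex n%:~R 0.
  exact: esym (rmorph_int (real_complex R) n).
by rewrite nm_real.
Qed.

Lemma nm_sum (I : Type) (r : seq I) (P : pred I) (F : I -> C R) :
  nm (\sum_(i <- r | P i) F i) <= \sum_(i <- r | P i) nm (F i).
Proof.
elim/big_rec2: _ => [|i a b _ h]; first by rewrite nm0.
by rewrite (le_trans (nmD _ _))// lerD2l.
Qed.

Lemma nm_sqr z : nm z ^+ 2 = complex.Re z ^+ 2 + complex.Im z ^+ 2.
Proof. by rewrite /nm normc_def /= sqr_sqrtr// addr_ge0// sqr_ge0. Qed.

Lemma Re_le_nm z : `|complex.Re z| <= nm z.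
Proof.
rewrite -(@ler_pXn2r _ 2)// ?nnegrE ?nm_ge0// nm_sqr real_normK ?num_real//.
by rewrite lerDl sqr_ge0.
Qed.

Lemma Im_le_nm z : `|complex.Im z| <= nm z.
Proof.
rewrite -(@ler_pXn2r _ 2)// ?nnegrE ?nm_ge0// nm_sqr real_normK ?num_real//.
by rewrite lerDr sqr_ge0.
Qed.

Lemma nm_le_ReIm z : nm z <= `|complex.Re z| + `|complex.Im z|.
Proof.
rewrite -(@ler_pXn2r _ 2)// ?nnegrE ?nm_ge0 ?addr_ge0// nm_sqr.
rewrite -(real_normK (num_real (complex.Re z))).
rewrite -(real_normK (num_real (complex.Im z))) sqrrD lerD2r lerDl.
by rewrite mulrn_wge0// mulr_ge0.
Qed.

Lemma cvg_nmP u l : u @ \oo --> l <->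
  forall e : R, 0 < e -> exists N, forall n, (N <= n)%N -> nm (u n - l) < e.
Proof.
split.
  move=> /cvgrPdist_lt h e e0.
  have /h[N _ hN] : 0 < (Complex e 0 : C R) by rewrite ltcE /= eqxx.
  exists N => n /hN /=.
  by rewrite distrC nmE ltcE /= eqxx.
move=> h; apply/cvgrPdist_lt => e e0.
have e0' : 0 < complex.Re e by move: e0; rewrite ltcE /= => /andP[].
have [N hN] := h _ e0'; exists N => // n /= /hN.
rewrite distrC nmE ltcE /= => ->; rewrite andbT.
by move: e0; rewrite ltcE /= => /andP[].
Qed.

Lemma cvg_nm0P u l : u @ \oo --> l <-> (fun n => nm (u n - l)) @ \oo --> (0 : R).
Proof.
rewrite cvg_nmP; split.
  move=> h; apply/cvgrPdist_lt => e /h[N hN]; exists N => // n /= /hN.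
  by rewrite sub0r normrN ger0_norm// nm_ge0.
move=> /cvgrPdist_lt h e /h[N _ hN]; exists N => n /hN /=.
by rewrite sub0r normrN ger0_norm// nm_ge0.
Qed.

Lemma cvg_Cunique u l (l' : C R) : u @ \oo --> l -> u @ \oo --> l' -> l = l'.
Proof. by move=> h h'; apply: (cvg_unique _ h h'); exact: norm_hausdorff. Qed.

Lemma nm_lim_le u v l (l' : C R) (B : R) : u @ \oo --> l -> v @ \oo --> l' ->
  (exists N, forall n, (N <= n)%N -> nm (u n - v n) <= B) -> nm (l - l') <= B.
Proof.
move=> /cvg_nmP hu /cvg_nmP hv [N hB]; apply/ler_addgt0Pr => e e0.
have [N1 h1] := hu (e / 2) (divr_gt0 e0 (ltr0Sn _ 1)).
have [N2 h2] := hv (e / 2) (divr_gt0 e0 (ltr0Sn _ 1)).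
pose n := maxn N (maxn N1 N2).
have a0 : (N <= n)%N by rewrite leq_maxl.
have a1 : (N1 <= n)%N by rewrite /n; lia.
have a2 : (N2 <= n)%N by rewrite /n; lia.
have := hB n a0; have := h1 n a1; have := h2 n a2.
have := nm_tri (u n) l l'; have := nm_tri (v n) (u n) l'.
rewrite (nmBC l (u n)); lra.
Qed.

Lemma cvg_ReIm u l : (fun n => complex.Re (u n)) @ \oo --> complex.Re l ->
  (fun n => complex.Im (u n)) @ \oo --> complex.Im l -> u @ \oo --> l.
Proof.
move=> /cvgrPdist_lt h1 /cvgrPdist_lt h2; apply/cvg_nmP => e e0.
have [N1 _ k1] := h1 (e / 2) (divr_gt0 e0 (ltr0Sn _ 1)).
have [N2 _ k2] := h2 (e / 2) (divr_gt0 e0 (ltr0Sn _ 1)).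
exists (maxn N1 N2) => n hn.
have /= a1 := k1 n (leq_trans (leq_maxl _ _) hn).
have /= a2 := k2 n (leq_trans (leq_maxr _ _) hn).
have := nm_le_ReIm (u n - l).
have -> : complex.Re (u n - l) = complex.Re (u n) - complex.Re l.
  by case: (u n) (l) => ? ? [].
have -> : complex.Im (u n - l) = complex.Im (u n) - complex.Im l.
  by case: (u n) (l) => ? ? [].
rewrite distrC in a1; rewrite distrC in a2; lra.
Qed.

Lemma Re_series u n : complex.Re (series u n) = series (fun i => complex.Re (u i)) n.
Proof.
rewrite /series /=; elim: n => [|n ih]; first by rewrite !big_geq.
by rewrite !big_nat_recr//= -ih; case: (bigop _ _ _) (u n) => ? ? [].
Qed.

Lemma Im_series u n : complex.Im (series u n) = series (fun i => complex.Im (u i)) n.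
Proof.
rewrite /series /=; elim: n => [|n ih]; first by rewrite !big_geq.
by rewrite !big_nat_recr//= -ih; case: (bigop _ _ _) (u n) => ? ? [].
Qed.

(** Real and imaginary parts are dominated by [B], so each converges absolutely in [R]. This
    provides the limits behind [limn] in [FGw] and [qpoch_inf]. *)
Lemma cvg_series_nm u (B : nat -> R) (K : R) :
  (forall n, nm (u n) <= B n) -> (forall n, series B n <= K) ->
  exists l : C R, series u @ \oo --> l.
Proof.
move=> hu hK.
have B0 n : 0 <= B n by rewrite (le_trans (nm_ge0 _) (hu n)).
have cB : cvgn (series B).
  apply: nondecreasing_is_cvgn; last by exists K => _ [n _ <-].
  by apply/nondecreasing_seqP => n; rewrite /series /= big_nat_recr//= lerDl.
have cf f : (forall n, `|f n| <= B n) -> cvgn (series (f : nat -> R^o)).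
  move=> hf; apply: normed_cvg; apply: (series_le_cvg _ _ _ cB) => n //=.
have cr := cf _ (fun n => le_trans (Re_le_nm _) (hu n)).
have ci := cf _ (fun n => le_trans (Im_le_nm _) (hu n)).
exists (Complex (limn (series (fun i => complex.Re (u i))))
                (limn (series (fun i => complex.Im (u i))))).
apply: cvg_ReIm => /=.
  by apply: (eq_cvgn cr) => n; rewrite Re_series.
by apply: (eq_cvgn ci) => n; rewrite Im_series.
Qed.

End ComplexModulus.

(** * Evaluation and norm of polynomials over the integers *)

Section WQSeries.
Variable R : realType.
Implicit Types (p q : {poly int}) (w : C R) (e : R).

(** Two regroupings rest on this: in [wq_sum] the total index is the power of q, in [expsumD] it is
    the degree in the exponential series. *)
Lemma sum_triangle (V : nmodType) (F : nat -> nat -> V) N :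
  \sum_(n < N) \sum_(s < n.+1) F s (n - s)%N =
  \sum_(s < N) \sum_(m < N - s) F s m.
Proof.
elim: N => [|N ih]; first by rewrite !big_ord0.
rewrite big_ord_recr /= ih [RHS]big_ord_recr /= [X in _ + X]big_ord_recr /=.
rewrite subSnn big_ord1 subnn addrA; congr (_ + _); rewrite -big_split /=.
by apply: eq_bigr => s _; rewrite subSn ?(ltnW (ltn_ord s))// big_ord_recr.
Qed.

(** Dominated convergence for sums of growing length: cut at an index [s0] beyond which the tail of
    [B] is below e / 2; the fixed head tends to 0 term by term. *)
Lemma tannery (x : nat -> nat -> R) (B : nat -> R) (K : R) :
  (forall N s, 0 <= x N s <= B s) -> (forall n, series B n <= K) ->
  (forall s, (fun N => x N s) @ \oo --> 0) ->
  (fun N => \sum_(s < N) x N s) @ \oo --> 0.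
Proof.
move=> xB BK x0.
have B0 n : 0 <= B n by have /andP[a b] := xB 0%N n; exact: le_trans a b.
have ndB : nondecreasing_seq (series B).
  by apply/nondecreasing_seqP => n; rewrite /series /= big_nat_recr//= lerDl.
have cB : cvgn (series B).
  by apply: nondecreasing_is_cvgn => //; exists K => _ [n _ <-].
have hd s0 : (fun N => \sum_(s < s0) x N s) @ \oo --> 0.
  elim: s0 => [|s0 ih].
    under eq_fun do rewrite big_ord0.
    exact: cvg_cst.
  under eq_fun do rewrite big_ord_recr /=.
  by have := cvgD ih (x0 s0); rewrite addr0; exact.
apply/cvgrPdist_lt => e e0.
have e2 : 0 < e / 2 by rewrite divr_gt0.
have /cvgrPdist_lt/(_ _ e2)[s0 _ hs0] := cB.
have /cvgrPdist_lt/(_ _ e2)[N0 _ hN0] := hd s0.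
exists (maxn s0 N0) => // N /= hN.
have sN : (s0 <= N)%N by rewrite (leq_trans (leq_maxl _ _) hN).
have := hN0 N (leq_trans (leq_maxr _ _) hN) => /=.
have := hs0 s0 (leqnn _) => /=.
have lB : series B N <= limn (series B) by apply: nondecreasing_cvgn_le.
rewrite !sub0r !normrN !ger0_norm; last first.
- by rewrite subr_ge0; apply: nondecreasing_cvgn_le.
- by apply: sumr_ge0 => i _; have /andP[] := xB N i.
- by apply: sumr_ge0 => i _; have /andP[] := xB N i.
move=> h1 h2.
rewrite -(big_mkord predT (x N)) (big_cat_nat (n := s0))//= big_mkord.
have : \sum_(s0 <= i < N) x N i <= series B N - series B s0.
  rewrite /series /= (@big_cat_nat _ _ _ s0 0 N)//= addrAC subrr add0r.
  by apply: ler_sum => i _; have /andP[] := xB N i.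
lra.
Qed.

Definition ev (w : C R) (p : {poly int}) : C R := (map_poly intr p).[w].

Lemma evD w p q : ev w (p + q) = ev w p + ev w q.
Proof. by rewrite /ev rmorphD hornerD. Qed.

Lemma evM w p q : ev w (p * q) = ev w p * ev w q.
Proof. by rewrite /ev rmorphM hornerM. Qed.

Lemma ev0 w : ev w 0 = 0.
Proof. by rewrite /ev rmorph0 horner0. Qed.

Lemma evC w (a : int) : ev w a%:P = a%:~R.
Proof. by rewrite /ev map_polyC hornerC. Qed.

Lemma evX w : ev w 'X = w.
Proof. by rewrite /ev map_polyX hornerX. Qed.

Lemma ev_sum w (I : Type) (r : seq I) (P : pred I) (F : I -> {poly int}) :
  ev w (\sum_(i <- r | P i) F i) = \sum_(i <- r | P i) ev w (F i).
Proof. by rewrite /ev rmorph_sum horner_sum. Qed.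

Lemma evE w p : ev w p = \sum_(i < size p) (p`_i)%:~R * w ^+ i.
Proof.
rewrite /ev (@horner_coef_wide _ (size p)) ?size_map_poly//; last first.
  by rewrite size_poly.
by apply: eq_bigr => i _; rewrite coef_map.
Qed.

(** A submultiplicative norm that bounds both the values on the disc |w| <= e ([ev_le]) and the
    single coefficients ([pnorm_coef]). *)
Definition pnorm (e : R) (p : {poly int}) : R :=
  \sum_(i < size p) `|p`_i|%:~R * e ^+ i.

Lemma pnormE e p n : (size p <= n)%N ->
  pnorm e p = \sum_(i < n) `|p`_i|%:~R * e ^+ i.
Proof.
move=> pn; rewrite /pnorm (big_ord_widen n (fun i => `|p`_i|%:~R * e ^+ i))//.
rewrite big_mkcond /=; apply: eq_bigr => i _; case: ltnP => // h.
by rewrite nth_default// normr0 mul0r.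
Qed.

Lemma pnorm0 e : pnorm e 0 = 0.
Proof. by rewrite /pnorm size_poly0 big_ord0. Qed.

Lemma pnormC e (a : int) : pnorm e a%:P = `|a|%:~R.
Proof.
rewrite (@pnormE _ _ 1) ?size_polyC ?leq_b1// big_ord1 coefC /=.
by rewrite expr0 mulr1.
Qed.

Lemma pnormX e : pnorm e 'X = e.
Proof.
by rewrite (@pnormE _ _ 2) ?size_polyX// !big_ord_recr big_ord0 /= !coefX /=
  normr0 normr1 mul0r !add0r mul1r.
Qed.

Section PNorm.
Variables (e : R) (e0 : 0 <= e).

Lemma pnorm_ge0 p : 0 <= pnorm e p.
Proof. by apply: sumr_ge0 => i _; rewrite mulr_ge0 ?exprn_ge0// ler0z. Qed.

Lemma pnormD p q : pnorm e (p + q) <= pnorm e p + pnorm e q.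
Proof.
have h := size_polyD p q; rewrite (pnormE _ h).
rewrite (pnormE e (leq_maxl _ (size q))) (pnormE e (leq_maxr (size p) _)).
rewrite -big_split /=; apply: ler_sum => i _; rewrite -mulrDl.
by rewrite ler_wpM2r ?exprn_ge0// -intrD ler_int coefD ler_normD.
Qed.

Lemma pnorm_sum (I : Type) (r : seq I) (P : pred I) (F : I -> {poly int}) :
  pnorm e (\sum_(i <- r | P i) F i) <= \sum_(i <- r | P i) pnorm e (F i).
Proof.
elim/big_rec2: _ => [|i a b _ h]; first by rewrite pnorm0.
by rewrite (le_trans (pnormD _ _))// lerD2l.
Qed.

Lemma pnormMX i p : pnorm e ('X^i * p) = e ^+ i * pnorm e p.
Proof.
rewrite (@pnormE _ _ (i + size p)); last first.
  by rewrite (leq_trans (size_polyMleq _ _))// size_polyXn addSn.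
rewrite big_split_ord /= big1 ?add0r; last first.
  by move=> j _; rewrite coefXnM ltn_ord normr0 mul0r.
rewrite /pnorm big_distrr /=; apply: eq_bigr => j _.
by rewrite coefXnM ltnNge leq_addr /= addKn exprD mulrCA.
Qed.

Lemma pnormZ (a : int) p : pnorm e (a *: p) = `|a|%:~R * pnorm e p.
Proof.
rewrite (pnormE _ (size_scale_leq a p)) /pnorm big_distrr /=.
by apply: eq_bigr => j _; rewrite coefZ normrM intrM mulrA.
Qed.

Lemma pnormM p q : pnorm e (p * q) <= pnorm e p * pnorm e q.
Proof.
rewrite {1}(_ : p = \sum_(i < size p) p`_i *: 'X^i); last first.
  by rewrite -[LHS]coefK poly_def.
rewrite mulr_suml (le_trans (pnorm_sum _ _ _))// [X in _ <= X * _]/pnorm.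
rewrite mulr_suml; apply: ler_sum => i _.
by rewrite -scalerAl pnormZ pnormMX mulrA.
Qed.

Lemma ev_le w p : nm w <= e -> nm (ev w p) <= pnorm e p.
Proof.
move=> we; rewrite evE (le_trans (nm_sum _ _ _))//; apply: ler_sum => i _.
by rewrite nmM nm_int nmX -intr_norm ler_wpM2l ?ler0z// lerXn2r ?nnegrE ?nm_ge0.
Qed.

Lemma pnorm_coef p l : `|p`_l|%:~R * e ^+ l <= pnorm e p.
Proof.
have [h|h] := ltnP l (size p); last first.
  by rewrite nth_default// normr0 mul0r pnorm_ge0.
rewrite /pnorm (bigD1 (Ordinal h))//= lerDl.
by apply: sumr_ge0 => i _; rewrite mulr_ge0 ?exprn_ge0// ler0z.
Qed.

End PNorm.

(** The remaining monomials have degree at least L, and comparing |w|^i with e^i yields (|w| / e)^L.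
    The bound is linear in [pnorm e p], so it can be summed over the coefficients of a series in
    q. *)
Lemma ev_tail (e : R) w p L : 0 < e -> nm w <= e ->
  nm (ev w p - \sum_(l < L) (p`_l)%:~R * w ^+ l) <= (nm w / e) ^+ L * pnorm e p.
Proof.
move=> e0 we.
have t0 : 0 <= nm w / e by rewrite divr_ge0 ?nm_ge0// ltW.
have t1 : nm w / e <= 1 by rewrite ler_pdivrMr// mul1r.
pose n := (L + size p)%N.
have -> : ev w p = \sum_(i < n) (p`_i)%:~R * w ^+ i.
  rewrite evE (big_ord_widen n (fun i => (p`_i)%:~R * w ^+ i)) ?leq_addl//.
  rewrite big_mkcond /=; apply: eq_bigr => i _; case: ltnP => // h.
  by rewrite nth_default// mul0r.
rewrite (@pnormE e p n) ?leq_addl// /n !big_split_ord /= addrAC subrr add0r.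
rewrite (le_trans (nm_sum _ _ _))// mulrDr -[leLHS]add0r lerD//.
  rewrite mulr_ge0 ?exprn_ge0// sumr_ge0// => i _.
  by rewrite mulr_ge0 ?exprn_ge0 ?ler0z// ltW.
rewrite big_distrr /=; apply: ler_sum => i _.
rewrite nmM nm_int nmX -intr_norm mulrCA ler_wpM2l ?ler0z//.
have -> : nm w ^+ (L + i) = (nm w / e) ^+ (L + i) * e ^+ (L + i).
  by rewrite -exprMn divfK ?gt_eqF.
rewrite ler_wpM2r ?exprn_ge0 ?(ltW e0)// exprD.
by rewrite ler_piMr ?exprn_ge0// exprn_ile1.
Qed.

End WQSeries.

(** * Power series in q with coefficients in Z[w] *)

Section WQClosure.
Variable R : realType.
Implicit Types (p : {poly int}) (w q : C R) (r : R).
Implicit Types (Phi Psi : C R -> C R -> C R) (K : R -> R).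

(* The radius is chosen so that |w q^m / (1 - q^m)^2| <= r^m / 2 for
   |w| <= wrad r, |q| = r < 1 and m >= 1. *)
Definition wrad (r : R) : R := (1 - r) ^+ 2 / 2.

Lemma wrad_gt0 r : r < 1 -> 0 < wrad r.
Proof. by move=> r1; rewrite divr_gt0// exprn_gt0// subr_gt0. Qed.

Lemma wrad_ge0 r : 0 <= wrad r.
Proof. by rewrite divr_ge0// sqr_ge0. Qed.

(** [c n] is the coefficient of q^n. As [K] sees only |q|, one majorant serves the whole disc in w
    and can be compared across infinite families of series. *)
Definition wq_series Phi K := exists c : nat -> {poly int},
  forall q, nm q < 1 ->
    (forall N, \sum_(n < N) pnorm (wrad (nm q)) (c n) * nm q ^+ n <= K (nm q)) /\
    (forall w, nm w <= wrad (nm q) ->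
       series (fun n => ev w (c n) * q ^+ n) @ \oo --> Phi w q).

Lemma wq_nm_le Phi K w q : wq_series Phi K -> nm q < 1 ->
  nm w <= wrad (nm q) -> nm (Phi w q) <= K (nm q).
Proof.
move=> [c hc] q1 hw; have [hK hcv] := hc q q1.
have hz : series (fun=> 0 : C R) @ \oo --> (0 : C R).
  rewrite (_ : series _ = cst 0); first exact: cvg_cst.
  by apply/funext => n; rewrite /series /= big1.
rewrite -(subr0 (Phi w q)); apply: nm_lim_le (hcv w hw) hz _.
exists 0%N => n _; rewrite /series /= [X in _ - X]big1// subr0.
rewrite big_mkord (le_trans (nm_sum _ _ _))// (le_trans _ (hK n))//.
apply: ler_sum => i _; rewrite nmM nmX ler_wpM2r ?exprn_ge0 ?nm_ge0//.
by apply: ev_le => //; exact: wrad_ge0.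
Qed.

Lemma wq_ge0 Phi K r : wq_series Phi K -> 0 <= r < 1 -> 0 <= K r.
Proof.
move=> [c hc] /andP[r0 r1].
have hr : nm (Complex r 0 : C R) = r by rewrite nm_real ger0_norm.
have [] := hc (Complex r 0); first by rewrite hr.
by move=> /(_ 0%N); rewrite big_ord0 hr.
Qed.

Lemma wq_le Phi K (K' : R -> R) : wq_series Phi K ->
  (forall r, 0 <= r < 1 -> K r <= K' r) -> wq_series Phi K'.
Proof.
move=> [c hc] KK; exists c => q q1; have [h1 h2] := hc q q1; split; last exact: h2.
move=> N.
by rewrite (le_trans (h1 N))// KK// nm_ge0.
Qed.

Lemma wq_ext Phi Psi K : wq_series Phi K ->
  (forall w q, nm q < 1 -> nm w <= wrad (nm q) -> Phi w q = Psi w q) ->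
  wq_series Psi K.
Proof.
move=> [c hc] e; exists c => q q1; have [h1 h2] := hc q q1; split; first exact: h1.
by move=> w hw; rewrite -(e w q q1 hw); exact: h2.
Qed.

Lemma wq_polyX p m :
  wq_series (fun w q => ev w p * q ^+ m) (fun r => pnorm (wrad r) p * r ^+ m).
Proof.
exists (fun n => if n == m then p else 0) => q q1; split.
  move=> N; have [h|h] := ltnP m N.
    rewrite (bigD1 (Ordinal h))//= eqxx big1 ?addr0// => i.
    by rewrite -val_eqE /= => /negbTE ->; rewrite pnorm0 mul0r.
  rewrite big1 ?mulr_ge0 ?exprn_ge0 ?nm_ge0 ?pnorm_ge0 ?wrad_ge0// => i _.
  by rewrite ltn_eqF ?pnorm0 ?mul0r// (leq_trans (ltn_ord i)).
move=> w hw; apply/cvg_nmP => e e0; exists m.+1 => n hn.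
rewrite /series /= big_mkord (bigD1 (Ordinal hn))//= eqxx big1 ?addr0.
  by rewrite subrr nm0.
by move=> i; rewrite -val_eqE /= => /negbTE ->; rewrite ev0 mul0r.
Qed.

Lemma wqD Phi Psi K K' : wq_series Phi K -> wq_series Psi K' ->
  wq_series (fun w q => Phi w q + Psi w q) (fun r => K r + K' r).
Proof.
move=> [c hc] [d hd]; exists (fun n => c n + d n) => q q1.
have [c1 c2] := hc q q1; have [d1 d2] := hd q q1; split.
  move=> N; rewrite (le_trans _ (lerD (c1 N) (d1 N)))// -big_split /=.
  apply: ler_sum => i _; rewrite -mulrDl ler_wpM2r ?exprn_ge0 ?nm_ge0//.
  exact/pnormD/wrad_ge0.
move=> w hw; apply: (eq_cvgn (cvgD (c2 w hw) (d2 w hw))) => N;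
rewrite /series /= ?fctE -big_split /=.
by apply: eq_bigr => i _; rewrite evD mulrDl.
Qed.

Lemma wq_polyM p Phi K : wq_series Phi K ->
  wq_series (fun w q => ev w p * Phi w q) (fun r => pnorm (wrad r) p * K r).
Proof.
move=> [c hc]; exists (fun n => p * c n) => q q1; have [c1 c2] := hc q q1.
have pe := wrad_ge0 (nm q).
split.
  move=> N; rewrite (le_trans _ (ler_wpM2l (pnorm_ge0 pe p) (c1 N)))//.
  rewrite mulr_sumr; apply: ler_sum => i _.
  by rewrite mulrA ler_wpM2r ?exprn_ge0 ?nm_ge0// pnormM.
move=> w hw; apply: (eq_cvgn (cvgM (cvg_cst (ev w p)) (c2 w hw))) => N;
rewrite /series /= ?fctE mulr_sumr.
by apply: eq_bigr => i _; rewrite evM mulrA.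
Qed.

(* Coefficientwise the sum is finite because of the factors q^s; Tannery's
   theorem identifies its value. *)
Lemma wq_sum (h : nat -> C R -> C R -> C R) (Ks : nat -> R -> R) Phi K :
  (forall s, wq_series (h s) (Ks s)) ->
  (forall r, 0 <= r < 1 -> forall N, \sum_(s < N) r ^+ s * Ks s r <= K r) ->
  (forall w q, nm q < 1 -> nm w <= wrad (nm q) ->
    series (fun s => q ^+ s * h s w q) @ \oo --> Phi w q) ->
  wq_series Phi K.
Proof.
move=> hh hK hcv.
have [c hc] := choice hh.
exists (fun n => \sum_(s < n.+1) c s (n - s)%N) => q q1.
have pe := wrad_ge0 (nm q).
have q0 := nm_ge0 q.
split.
  move=> N; have q01 : 0 <= nm q < 1 by rewrite q0.
  rewrite (le_trans _ (hK _ q01 N))//.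
  pose G s m := nm q ^+ s * (pnorm (wrad (nm q)) (c s m) * nm q ^+ m).
  rewrite (@le_trans _ _ (\sum_(n < N) \sum_(s < n.+1) G s (n - s)%N))//.
    apply: ler_sum => n _.
    rewrite (le_trans (ler_wpM2r _ (pnorm_sum pe _ _ _)))// ?exprn_ge0//.
    rewrite mulr_suml; apply: ler_sum => s _.
    by rewrite /G mulrCA -exprD subnKC// -ltnS.
  rewrite sum_triangle; apply: ler_sum => s _; rewrite -mulr_sumr.
  by rewrite ler_wpM2l ?exprn_ge0//; have [+ _] := hc s q q1; exact.
move=> w hw.
pose S s := series (fun n => ev w (c s n) * q ^+ n).
have Sle s n : nm (S s n) <= Ks s (nm q).
  have [h1 _] := hc s q q1; rewrite (le_trans _ (h1 n))// /S /series /= big_mkord.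
  rewrite (le_trans (nm_sum _ _ _))//; apply: ler_sum => i _.
  by rewrite nmM nmX ler_wpM2r ?exprn_ge0// ev_le.
(* The weighted error of cutting the series of [h s] after N - s terms. Summed over s it bounds the
   distance between the triangular partial sum and [T] below. *)
pose x N s := nm q ^+ s * nm (S s (N - s)%N - h s w q).
have xs : (fun N => \sum_(s < N) x N s) @ \oo --> 0.
  apply: (@tannery _ x (fun s => nm q ^+ s * (2 * Ks s (nm q))) (2 * K (nm q))).
  - move=> N s; rewrite /x mulr_ge0 ?exprn_ge0 ?nm_ge0//= ler_wpM2l ?exprn_ge0//.
    rewrite mulr_natl mulr2n (le_trans (nmB _ _))// lerD//.
    exact: wq_nm_le.
  - move=> n; rewrite /series /= big_mkord.
    under eq_bigr do rewrite mulrCA.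
    by rewrite -mulr_sumr ler_pM2l// hK// q0.
  - move=> s; have [_ /(_ w hw)/cvg_nmP h2] := hc s q q1.
    apply/cvgrPdist_lt => e /h2[N hN]; exists (N + s)%N => // n /= hn.
    rewrite sub0r normrN ger0_norm /x ?mulr_ge0 ?exprn_ge0 ?nm_ge0//.
    have /hN : (N <= n - s)%N by lia.
    by apply: le_lt_trans; rewrite ler_piMl ?nm_ge0// exprn_ile1// ltW.
have /cvg_nm0P h0 := hcv w q q1 hw.
apply/cvg_nm0P.
have := cvgD xs h0; rewrite addr0 => hD.
apply: squeeze0 (hD _) => N; rewrite nm_ge0 /= ?fctE.
pose T := series (fun s => q ^+ s * h s w q) N.
apply: le_trans (nm_tri T _ _) _; rewrite lerD2r.
rewrite /T /series /= !big_mkord.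
pose G s m := q ^+ s * (ev w (c s m) * q ^+ m).
have -> : \sum_(n < N) ev w (\sum_(s < n.+1) c s (n - s)%N) * q ^+ n =
    \sum_(n < N) \sum_(s < n.+1) G s (n - s)%N.
  apply: eq_bigr => n _; rewrite ev_sum mulr_suml; apply: eq_bigr => s _.
  by rewrite /G mulrCA -exprD subnKC// -ltnS.
rewrite sum_triangle -sumrB (le_trans (nm_sum _ _ _))//.
apply: ler_sum => s _; rewrite -mulr_sumr -mulrBr nmM nmX /x /S.
by rewrite /series /= big_mkord.
Qed.

(** Expanding only the first factor gives the sum of q^s (c_s Psi), an instance of [wq_sum]; the
    Cauchy product is thus already done there. *)
Lemma wqM Phi Psi K K' : wq_series Phi K -> wq_series Psi K' ->
  wq_series (fun w q => Phi w q * Psi w q) (fun r => K r * K' r).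
Proof.
move=> [c hc] hPsi.
apply: (@wq_sum (fun s w q => ev w (c s) * Psi w q)
  (fun s r => pnorm (wrad r) (c s) * K' r)).
- by move=> s; exact: wq_polyM.
- move=> r /andP[r0 r1] N.
  have hr : nm (Complex r 0 : C R) = r by rewrite nm_real ger0_norm.
  have [] := hc (Complex r 0); first by rewrite hr.
  move=> /(_ N); rewrite hr => h _.
  have K'0 : 0 <= K' r by apply: wq_ge0 hPsi _; rewrite r0.
  rewrite (le_trans _ (ler_wpM2r K'0 h))// mulr_suml.
  by apply: ler_sum => i _; rewrite mulrA (mulrC (r ^+ _)).
- move=> w q q1 hw; have [_ c2] := hc q q1.
  apply: (eq_cvgn (cvgM (c2 w hw) (cvg_cst (Psi w q)))) => N;
rewrite /series /= ?fctE mulr_suml.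
  by apply: eq_bigr => i _; rewrite mulrA (mulrC (q ^+ _)).
Qed.

Lemma wq_conv Phi Psi K (K' : R -> R) : wq_series Phi K ->
  (forall w q, nm q < 1 -> nm w <= wrad (nm q) -> Phi w q = Psi w q) ->
  (forall r, 0 <= r < 1 -> K r <= K' r) -> wq_series Psi K'.
Proof. by move=> h e hK; apply: wq_le hK; apply: wq_ext e. Qed.

Lemma wq_poly p : wq_series (fun w _ => ev w p) (fun r => pnorm (wrad r) p).
Proof.
by apply: wq_conv (wq_polyX p 0) _ _ => [w q _ _|r _] /=; rewrite expr0 mulr1.
Qed.

Lemma wq_int (a : int) : wq_series (fun _ _ => a%:~R) (fun=> `|a|%:~R).
Proof.
by apply: wq_conv (wq_poly a%:P) _ _ => [w q _ _|r _] /=; rewrite ?evC ?pnormC.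
Qed.

Lemma wq_qX m : wq_series (fun _ q => q ^+ m) (fun r => r ^+ m).
Proof.
apply: wq_conv (wq_polyX 1%:P m) _ _ => [w q _ _|r _] /=.
  by rewrite evC mul1r.
by rewrite pnormC mul1r.
Qed.

Lemma wqX Phi K m : wq_series Phi K ->
  wq_series (fun w q => Phi w q ^+ m) (fun r => K r ^+ m).
Proof.
move=> h; elim: m => [|m ih].
  by apply: wq_conv (wq_int 1) _ _.
by apply: wq_conv (wqM h ih) _ _ => [w q _ _|r _] /=; rewrite exprS.
Qed.

Lemma wq_sumn (h : nat -> C R -> C R -> C R) (Ks : nat -> R -> R) (I : pred nat) n :
  (forall s, I s -> wq_series (h s) (Ks s)) ->
  wq_series (fun w q => \sum_(0 <= s < n | I s) h s w q)
            (fun r => \sum_(0 <= s < n | I s) Ks s r).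
Proof.
move=> hh; elim: n => [|n ih].
  by apply: wq_conv (wq_int 0) _ _ => [w q _ _|r _] /=; rewrite big_geq.
have [In|In] := boolP (I n).
  apply: wq_conv (wqD ih (hh n In)) _ _ => [w q _ _|r _] /=.
    by rewrite [RHS]big_mkcond big_nat_recr //= In -big_mkcond.
  by rewrite [leRHS]big_mkcond big_nat_recr //= In -big_mkcond.
apply: wq_conv ih _ _ => [w q _ _|r _] /=.
  by rewrite [RHS]big_mkcond big_nat_recr //= (negbTE In) -big_mkcond addr0.
by rewrite [leRHS]big_mkcond big_nat_recr //= (negbTE In) -big_mkcond addr0.
Qed.

Lemma wq_prodn (h : nat -> C R -> C R -> C R) (Ks : nat -> R -> R) n :
  (forall s, wq_series (h s) (Ks s)) ->
  wq_series (fun w q => \prod_(s < n) h s w q) (fun r => \prod_(s < n) Ks s r).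
Proof.
move=> hh; elim: n => [|n ih].
  by apply: wq_conv (wq_int 1) _ _ => [w q _ _|r _] /=; rewrite big_ord0.
by apply: wq_conv (wqM ih (hh n)) _ _ => [w q _ _|r _] /=; rewrite big_ord_recr.
Qed.

Lemma cvg_geom (x : C R) : nm x < 1 ->
  series (fun s => x ^+ s) @ \oo --> (1 - x)^-1.
Proof.
move=> x1.
have nx : 1 - x != 0.
  by rewrite subr_eq0; apply: contraTneq x1 => <-; rewrite nm1 ltxx.
have x1' : `|nm x| < 1 by rewrite ger0_norm ?nm_ge0.
apply/cvg_nmP => e e0; have n0 : 0 < nm (1 - x) by rewrite nm_gt0.
have /cvgrPdist_lt/(_ _ (mulr_gt0 e0 n0))[N _ hN] := cvg_expr x1'.
exists N => n /hN /=; rewrite sub0r normrN ger0_norm ?exprn_ge0 ?nm_ge0//.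
rewrite -ltr_pdivrMr// -nmX -nmV -nmM; congr (_ < e).
rewrite nmBC; congr nm; apply: (mulfI nx).
have h : (1 - x) * series (fun s => x ^+ s) n = 1 - x ^+ n.
  by rewrite /series /= big_mkord -opprB mulNr -subrX1 opprB.
by rewrite mulrBr h mulrCA divff// mulr1 subKr.
Qed.

(** The sum of q^s Phi^s has the shape required by [wq_sum], and the hypothesis makes the series of
    majorants geometric as well. *)
Lemma wq_geom Phi K : wq_series Phi K ->
  (forall r, 0 <= r < 1 -> r * K r < 1) ->
  wq_series (fun w q => (1 - q * Phi w q)^-1) (fun r => (1 - r * K r)^-1).
Proof.
move=> h hK; apply: wq_sum (fun s => wqX s h) _ _.
  move=> r r01 N; have K0 := wq_ge0 h r01; have rK := hK r r01.
  have rK0 : 0 <= r * K r by rewrite mulr_ge0//; case/andP: r01.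
  rewrite -[leRHS]mul1r ler_pdivlMr ?subr_gt0//.
  under eq_bigr do rewrite -exprMn.
  rewrite mulrC -opprB mulNr -subrX1 opprB gerBl exprn_ge0//.
move=> w q q1 hw.
under eq_fun do rewrite -exprMn.
apply: cvg_geom; rewrite nmM; apply: le_lt_trans (hK (nm q) _); last first.
  by rewrite nm_ge0.
by rewrite ler_wpM2l ?nm_ge0//; exact: wq_nm_le h _ _.
Qed.

End WQClosure.

(** * The summands of FG *)

Section QSeries.
Variable R : realType.
Implicit Types (w q : C R) (r : R).

Lemma sum_expr_le r n : 0 <= r < 1 -> \sum_(m < n) r ^+ m <= (1 - r)^-1.
Proof.
move=> /andP[r0 r1]; rewrite -[leRHS]mul1r ler_pdivlMr ?subr_gt0//.
by rewrite mulrC -opprB mulNr -subrX1 opprB gerBl exprn_ge0.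
Qed.

(** The exponents add up to a times a sum of powers of r, at most a r / (1 - r) for every length
    n. *)
Lemma prod_expR_le (F : nat -> R) (a r : R) n : 0 <= a -> 0 <= r < 1 ->
  (forall m, 0 <= F m <= expR (a * r ^+ m.+1)) ->
  \prod_(m < n) F m <= expR (a * (r / (1 - r))).
Proof.
move=> a0 r01 hF.
apply: (@le_trans _ _ (\prod_(m < n) expR (a * r ^+ m.+1))).
  by apply: ler_prod.
rewrite -expR_sum ler_expR -mulr_sumr ler_wpM2l//.
under eq_bigr do rewrite exprS.
rewrite -mulr_sumr ler_wpM2l ?sum_expr_le//.
by case/andP: r01.
Qed.

(** The number 1 + c t lies between the two sides: (1 - t) (1 + c t) >= 1 follows from c (1 - t) >=
    1, which is the upper bound on t. *)
Lemma inv1B_le (t : R) (c : R) : 0 <= t -> t <= 1 - c^-1 -> 0 < c ->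
  (1 - t)^-1 <= expR (c * t).
Proof.
move=> t0 tc c0.
have t1 : 0 < 1 - t by rewrite subr_gt0 (le_lt_trans tc)// gtrBl invr_gt0.
apply: (le_trans _ (expR_ge1Dx _)); rewrite -[leLHS]mul1r ler_pdivrMr//.
have : t <= t * (c * (1 - t)).
  rewrite -[leLHS]mulr1 ler_wpM2l// -ler_pdivrMl// mulr1.
  by rewrite lerBrDl -lerBrDr.
lra.
Qed.

Lemma exprS_lt1 r m : 0 <= r < 1 -> r * r ^+ m <= r.
Proof. by move=> /andP[r0 r1]; rewrite ler_piMr// exprn_ile1// ltW. Qed.

Lemma inv1Bq_le r m : 0 <= r < 1 ->
  (1 - r * r ^+ m)^-1 <= expR ((1 - r)^-1 * r ^+ m.+1).
Proof.
(* For c = 1 / (1 - r) the threshold 1 - 1 / c is r itself. *)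
move=> /[dup] r01 /andP[r0 r1]; rewrite -exprS; apply: inv1B_le.
- by rewrite exprn_ge0.
- by rewrite invrK subKr exprS exprS_lt1.
- by rewrite invr_gt0 subr_gt0.
Qed.

Lemma wq_qpoch n :
  wq_series (fun _ q : C R => qpoch q q n) (fun r => expR (1 * (r / (1 - r)))).
Proof.
have h m : wq_series (fun _ q : C R => 1 - q * q ^+ m) (fun r => 1 + r ^+ m.+1).
  apply: wq_conv (wqD (wq_int _ 1) (wqM (wq_int _ (-1)) (wq_qX _ m.+1))) _ _.
    by move=> w q _ _ /=; rewrite mulN1r exprS.
  by move=> r _ /=; rewrite normrN1 mul1r.
apply: wq_le (wq_prodn n h) _ => r r01 /=.
apply: (@prod_expR_le (fun m => 1 + r ^+ m.+1)) => // m; rewrite mul1r expR_ge1Dx andbT.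
by rewrite addr_ge0// exprn_ge0//; case/andP: r01.
Qed.

Lemma wq_inv1Bq m :
  wq_series (fun _ q : C R => (1 - q * q ^+ m)^-1) (fun r => (1 - r * r ^+ m)^-1).
Proof.
apply: (wq_geom (wq_qX _ m)) => r /[dup] /exprS_lt1 h /andP[r0].
exact: le_lt_trans.
Qed.

Lemma wq_qpochV n :
  wq_series (fun _ q : C R => (qpoch q q n)^-1)
    (fun r => expR ((1 - r)^-1 * (r / (1 - r)))).
Proof.
apply: wq_conv (wq_prodn n wq_inv1Bq) _ _ => [w q _ _|r r01] /=.
  by rewrite /qpoch prodfV.
apply: (@prod_expR_le (fun m => (1 - r * r ^+ m)^-1)) => // [|m].
  by rewrite invr_ge0 subr_ge0 ltW//; case/andP: r01.
rewrite inv1Bq_le// andbT invr_ge0 subr_ge0 (le_trans (exprS_lt1 m r01))//.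
by rewrite ltW//; case/andP: r01.
Qed.

Lemma onemq_neq0 q m : nm q < 1 -> 1 - q * q ^+ m != 0.
Proof.
move=> q1; rewrite -exprS subr_eq0; apply: contraTneq q1 => h.
have : nm (q ^+ m.+1) = 1 by rewrite -h nm1.
rewrite nmX -leNgt => h1; rewrite leNgt; apply/negP => q1.
by move: h1; apply/eqP; rewrite lt_eqF// exprn_ilt1// nm_ge0.
Qed.

Definition rank_den w q m : C R := (1 - q * q ^+ m) ^+ 2 - q * q ^+ m * w.

Lemma rank_den_bound r m : 0 <= r < 1 ->
  r * (wrad r * r ^+ m * (1 - r * r ^+ m)^-1 ^+ 2) <= r ^+ m.+1 / 2.
Proof.
move=> /[dup] r01 /andP[r0 r1]; have h := exprS_lt1 m r01.
have x0 : 0 < 1 - r * r ^+ m by rewrite subr_gt0 (le_lt_trans h).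
set D := 1 - r * r ^+ m in x0 *.
have -> : r * (wrad r * r ^+ m * D^-1 ^+ 2) = r ^+ m.+1 * (wrad r * D^-1 ^+ 2).
  by rewrite (exprS r); ring.
rewrite ler_wpM2l ?exprn_ge0// exprVn ler_pdivrMr ?exprn_gt0// [leRHS]mulrC /wrad.
rewrite ler_wpM2r// lerXn2r ?nnegrE ?(ltW x0) ?subr_ge0 ?(ltW r1)//.
by rewrite lerB.
Qed.

(** With D = 1 - q^(m+1), the inverse is D^(-2) times the geometric series in q^(m+1) w / D^2, whose
    ratio is at most r^(m+1) / 2. In the exponent, 2 / (1 - r) stems from D^(-2), and 1 from
    [inv1B_le] with c = 2. *)
Lemma wq_rank_denV m : wq_series (fun w q => (rank_den w q m)^-1)
  (fun r => expR ((2 * (1 - r)^-1 + 1) * r ^+ m.+1)).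
Proof.
have h1 := wqX 2 (wq_inv1Bq m).
have h2 := wqM (wqM (wq_poly R 'X) (wq_qX R m)) h1.
have h3 : wq_series
    (fun w q : C R => (1 - q * (w * q ^+ m * (1 - q * q ^+ m)^-1 ^+ 2))^-1)
    (fun r => (1 - r * (wrad r * r ^+ m * (1 - r * r ^+ m)^-1 ^+ 2))^-1).
  apply: wq_conv (wq_geom h2 _) _ _ => [r r01|w q _ _|r _] /=.
  - rewrite pnormX (le_lt_trans (rank_den_bound m r01))//.
    have := exprS_lt1 m r01; rewrite -exprS; case/andP: r01 => r0 r1; lra.
  - by rewrite evX.
  - by rewrite pnormX.
apply: wq_conv (wqM h1 h3) _ _ => [w q q1 _|r r01] /=.
  rewrite [X in X * _]exprVn -invfM; congr (_^-1); rewrite /rank_den.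
  have := onemq_neq0 m q1; set D := 1 - q * q ^+ m => D0.
  rewrite exprVn mulrBr mulr1; congr (_ - _).
  by field.
have r0 : 0 <= r by case/andP: r01.
have r1 : r < 1 by case/andP: r01.
rewrite mulrDl expRD ler_pM ?exprn_ge0 ?invr_ge0//.
- by rewrite subr_ge0 (le_trans (exprS_lt1 m r01))// ltW.
- rewrite subr_ge0 (le_trans (rank_den_bound m r01))//.
  have h := exprS_lt1 m r01; rewrite -exprS in h; lra.
- rewrite -mulrA expRM_natl lerXn2r ?nnegrE ?expR_ge0 ?inv1Bq_le//.
  by rewrite invr_ge0 subr_ge0 (le_trans (exprS_lt1 m r01))// ltW.
have hb := rank_den_bound m r01.
apply: le_trans (inv1B_le (c := 2) _ _ _) _ => //.
- have : 0 <= (1 - r * r ^+ m)^-1.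
    by rewrite invr_ge0 subr_ge0 (le_trans (exprS_lt1 m r01))// ltW.
  move=> d0; apply: mulr_ge0 => //; apply: mulr_ge0; last exact: exprn_ge0.
  by apply: mulr_ge0; [exact: wrad_ge0|exact: exprn_ge0].
- have h := exprS_lt1 m r01; rewrite -exprS in h; lra.
- rewrite ler_expR; lra.
Qed.

(* The sum over n_1, ..., n_i for fixed n_(i+1) = n, without q^(n^2). *)
Fixpoint FGhead (i : nat) w q (n : nat) : C R :=
  if i is i'.+1 then
    \sum_(0 <= m < n.+1 | (0 < m)%N)
      FGhead i' w q m * (q ^+ (m ^ 2) / qpoch q q (n - m))
  else \prod_(m < n) (rank_den w q m)^-1.

(** The first factor bounds the product of the 1 / [rank_den]; each of the i summations costs a
    bound for 1 / (q)_(n-m) and one for the sum of r^(m^2). Nothing depends on n. *)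
Definition FGheadK i r : R :=
  expR ((2 * (1 - r)^-1 + 1) * (r / (1 - r))) *
  (expR ((1 - r)^-1 * (r / (1 - r))) * (1 - r)^-1) ^+ i.

Lemma FGheadK_ge0 i r : 0 <= r < 1 -> 0 <= FGheadK i r.
Proof.
move=> /andP[_ r1]; rewrite mulr_ge0 ?expR_ge0// exprn_ge0// mulr_ge0 ?expR_ge0//.
by rewrite invr_ge0 subr_ge0 ltW.
Qed.

Lemma leq_sqr m : (m <= m ^ 2)%N.
Proof. by case: m => // m; rewrite -[leqLHS]muln1 leq_mul. Qed.

Lemma wq_FGhead i n : wq_series (fun w q => FGhead i w q n) (FGheadK i).
Proof.
elim: i n => [|i ih] n.
  apply: wq_le (wq_prodn n wq_rank_denV) _ => r /[dup] r01 /andP[r0 r1] /=.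
  rewrite /FGheadK expr0 mulr1.
  apply: (@prod_expR_le (fun m => expR ((2 * (1 - r)^-1 + 1) * r ^+ m.+1))) => //.
    by rewrite addr_ge0// mulr_ge0// invr_ge0 subr_ge0 ltW.
  by move=> m; rewrite expR_ge0 lexx.
have h m : (0 < m)%N -> wq_series
    (fun w q => FGhead i w q m * (q ^+ (m ^ 2) / qpoch q q (n - m)))
    (fun r => FGheadK i r * (r ^+ (m ^ 2) * expR ((1 - r)^-1 * (r / (1 - r))))).
  by move=> _; exact: wqM (ih m) (wqM (wq_qX R _) (wq_qpochV _)).
apply: wq_le (wq_sumn _ h) _ => r /[dup] r01 /andP[r0 r1] /=.
have -> : FGheadK i.+1 r =
    FGheadK i r * ((1 - r)^-1 * expR ((1 - r)^-1 * (r / (1 - r)))).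
  by rewrite /FGheadK (exprS _ i) -!mulrA; congr (_ * _); rewrite mulrC; ring.
rewrite -mulr_sumr -mulr_suml ler_wpM2l ?FGheadK_ge0// ler_wpM2r ?expR_ge0//.
apply: le_trans (sum_expr_le n.+1 r01); rewrite -(big_mkord predT).
rewrite big_mkcond /=; apply: ler_sum => m _; case: ifP => _; last exact: exprn_ge0.
by rewrite ler_wiXn2l ?leq_sqr// ltW.
Qed.

(** The value at 0 encodes n_1 >= 1: for i = 0 the empty product in [FGhead] would contribute 1. *)
Definition FGlast i w q (s : nat) : C R :=
  if s is 0 then 0 else q ^+ (s ^ 2) * FGhead i w q s.

(** As s <= s^2, the factor q^s demanded by [wq_sum] splits off, and the leftover power of q does
    not increase the majorant. *)
Lemma wq_FGlast i s : exists h : C R -> C R -> C R,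
  wq_series h (FGheadK i) /\ forall w q, FGlast i w q s = q ^+ s * h w q.
Proof.
case: s => [|s].
  exists (fun _ _ => 0); split => [|w q]; last by rewrite mulr0.
  apply: wq_conv (wq_int R 0) _ _ => // r r01.
  by rewrite normr0 FGheadK_ge0.
exists (fun w q => q ^+ (s.+1 ^ 2 - s.+1) * FGhead i w q s.+1); split => [|w q].
  apply: wq_le (wqM (wq_qX R _) (wq_FGhead i s.+1)) _ => r /[dup] r01 /andP[r0 r1] /=.
  by rewrite ler_piMl ?FGheadK_ge0// exprn_ile1// ltW.
by rewrite mulrA -exprD subnKC ?leq_sqr.
Qed.

Definition FGw i w q : C R := limn (series (FGlast i w q)).

Lemma cvg_FGw i w q : nm q < 1 -> nm w <= wrad (nm q) ->
  series (FGlast i w q) @ \oo --> FGw i w q.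
Proof.
move=> q1 hw.
have [l hl] : exists l : C R, series (FGlast i w q) @ \oo --> l.
  have q01 : 0 <= nm q < 1 by rewrite nm_ge0.
  apply: (@cvg_series_nm _ _ (fun s => nm q ^+ s * FGheadK i (nm q))
    ((1 - nm q)^-1 * FGheadK i (nm q))) => n.
    have [h [hh ->]] := wq_FGlast i n; rewrite nmM nmX.
    rewrite ler_wpM2l ?exprn_ge0 ?nm_ge0//; exact: wq_nm_le hh _ _.
  rewrite /series /= big_mkord -mulr_suml ler_wpM2r ?FGheadK_ge0//.
  exact: sum_expr_le.
by rewrite /FGw; apply: cvgP hl.
Qed.

Lemma wq_FGw i : wq_series (FGw i) (fun r => (1 - r)^-1 * FGheadK i r).
Proof.
have [h hh] := choice (wq_FGlast i).
apply: (wq_sum (fun s => (hh s).1)) => [r r01 N|w q q1 hw].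
  by rewrite -mulr_suml ler_wpM2r ?FGheadK_ge0 ?sum_expr_le.
rewrite (_ : (fun s => _) = FGlast i w q); first exact: cvg_FGw.
by apply/funext => s; rewrite (hh s).2.
Qed.

End QSeries.

(** * The Euler product, and FG as a function of w *)

Section FGIdentity.
Variable R : realType.
Implicit Types (w q zeta : C R).

Lemma qpochS (a q : C R) n : qpoch a q n.+1 = qpoch a q n * (1 - a * q ^+ n).
Proof. by rewrite /qpoch big_ord_recr. Qed.

(* (q)_oo = 1 - sum_s q^(s+1) (q)_s, by telescoping. *)
Definition euler_term q (s : nat) : C R := if s is s'.+1 then - qpoch q q s' else 1.

Lemma series_euler_term q n :
  series (fun s => q ^+ s * euler_term q s) n.+1 = qpoch q q n.
Proof.
elim: n => [|n ih]; first by rewrite /series /= big_nat1 /qpoch big_ord0 mulr1.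
by rewrite seriesSr ih qpochS /= exprS; ring.
Qed.

Definition euler_bound (r : R) : R := 1 + expR (1 * (r / (1 - r))).

Lemma wq_euler_term s : wq_series (fun _ q => euler_term q s) euler_bound.
Proof.
have hb (r : R) : 0 <= r < 1 -> 1 <= euler_bound r.
  by move=> _; rewrite lerDl expR_ge0.
case: s => [|s].
  by apply: wq_conv (wq_int R 1) _ _ => // r /hb; rewrite normr1.
apply: wq_conv (wqM (wq_int R (-1)) (wq_qpoch R s)) _ _ => [w q _ _|r _] /=.
  by rewrite mulN1r.
by rewrite normrN1 [leLHS](mul1r (expR _)) /euler_bound lerDr.
Qed.

Lemma cvg_qpoch_inf q : nm q < 1 -> qpoch q q @ \oo --> qpoch_inf q q.
Proof.
move=> q1.
have q01 : 0 <= nm q < 1 by rewrite nm_ge0.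
have w0 : nm (0 : C R) <= wrad (nm q) by rewrite nm0 wrad_ge0.
have b0 : 0 <= euler_bound (nm q) by rewrite addr_ge0 ?expR_ge0.
have [l hl] : exists l : C R, series (fun s => q ^+ s * euler_term q s) @ \oo --> l.
  apply: (@cvg_series_nm _ _ (fun s => nm q ^+ s * euler_bound (nm q))
    ((1 - nm q)^-1 * euler_bound (nm q))) => n.
    rewrite nmM nmX ler_wpM2l ?exprn_ge0 ?nm_ge0//.
    exact: (wq_nm_le (wq_euler_term n) q1 w0).
  rewrite /series /= big_mkord -mulr_suml ler_wpM2r//.
  exact: sum_expr_le.
have {}hl : qpoch q q @ \oo --> l.
  move/cvg_nmP: hl => hl; apply/cvg_nmP => e /hl[N hN]; exists N => n hn.
  by rewrite -series_euler_term; apply: hN; rewrite leqW.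
exact: cvgP hl.
Qed.

Lemma wq_qpoch_inf : wq_series (fun _ q : C R => qpoch_inf q q)
  (fun r => (1 - r)^-1 * euler_bound r).
Proof.
apply: (wq_sum wq_euler_term) => [r r01 N|w q q1 hw].
  rewrite -mulr_suml ler_wpM2r ?sum_expr_le//.
  by rewrite addr_ge0 ?expR_ge0.
have /cvg_nmP hl := cvg_qpoch_inf q1; apply/cvg_nmP => e /hl[N hN].
exists N.+1 => -[//|n] hn.
by rewrite series_euler_term; exact: hN.
Qed.

(** The inverses 1 / (q)_n are bounded uniformly in n by [wq_qpochV], so |(q)_n| stays away from
    0. *)
Lemma qpoch_inf_neq0 q : nm q < 1 -> qpoch_inf q q != 0.
Proof.
move=> q1.
have w0 : nm (0 : C R) <= wrad (nm q) by rewrite nm0 wrad_ge0.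
pose M := expR ((1 - nm q)^-1 * (nm q / (1 - nm q))).
have M0 : 0 < M by exact: expR_gt0.
have hM n : M^-1 <= nm (qpoch q q n).
  have := wq_nm_le (wq_qpochV R n) q1 w0; rewrite nmV => h.
  have p0 : 0 < nm (qpoch q q n).
    rewrite nm_gt0; apply/prodf_neq0 => m _; exact: onemq_neq0.
  by rewrite -[leRHS]invrK lef_pV2 ?posrE ?invr_gt0.
apply/negP => /eqP h0.
have /cvg_nmP/(_ M^-1) := cvg_qpoch_inf q1; rewrite invr_gt0 => /(_ M0)[N hN].
have := hN N (leqnn N); rewrite h0 subr0 => h.
by have := le_lt_trans (hM N) h; rewrite ltxx.
Qed.

Lemma rank_den_zeta zeta q m : zeta != 0 ->
  (1 - zeta * q * q ^+ m) * (1 - zeta^-1 * q * q ^+ m) =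
  rank_den (zeta + zeta^-1 - 2) q m.
Proof. by move=> z0; rewrite /rank_den; field. Qed.

Lemma FGhead0_zeta zeta q n : zeta != 0 ->
  FGhead 0 (zeta + zeta^-1 - 2) q n =
  (qpoch (zeta * q) q n * qpoch (zeta^-1 * q) q n)^-1.
Proof.
move=> z0; rewrite /= prodfV /qpoch -big_split /=.
by congr (_^-1); apply: eq_bigr => m _; rewrite -rank_den_zeta.
Qed.

Lemma big_tuple_cons (V : nmodType) (T : finType) n (P : pred (seq T))
    (F : seq T -> V) :
  \sum_(t : n.+1.-tuple T | P t) F t =
  \sum_(a : T) \sum_(t : n.-tuple T | P (a :: t)) F (a :: t).
Proof.
rewrite (pair_big_dep xpredT (fun a (t : n.-tuple T) => P (a :: t))
  (fun a (t : n.-tuple T) => F (a :: t))) /=.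
rewrite (reindex (fun p : T * n.-tuple T => [tuple of p.1 :: p.2])) //=.
exists (fun t : n.+1.-tuple T => (thead t, [tuple of behead t])).
  by move=> [a t] _ /=; congr (_, _); apply: val_inj.
by move=> t _; apply: val_inj => /=; case/tupleP: t => a t.
Qed.

(** [FG_term] without its two factors in zeta, which depend on n_1 alone. *)
Definition chain_wt q (s : seq nat) : C R :=
  q ^+ (\sum_(n <- s) n ^ 2)%N /
  \prod_(i < (size s).-1) qpoch q q (nth 0%N s i.+1 - nth 0%N s i)%N.

Lemma chain_wt_cons q a b s :
  chain_wt q [:: a, b & s] = q ^+ (a ^ 2) / qpoch q q (b - a) * chain_wt q (b :: s).
Proof.
rewrite /chain_wt big_cons exprD /= big_ord_recl /= invfM -!mulrA.
by congr (_ * _); rewrite mulrCA.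
Qed.

(* Summing out n_1 turns the weight W of the head into a weight of the same kind
   on n_2; see chain_sumS. *)
Definition chain_sum q (i N : nat) (W : nat -> C R) : C R :=
  \sum_(t : i.+1.-tuple 'I_N.+1 |
      let s := [seq val j | j <- t] in sorted leq s && (0 < head 0 s)%N)
    W (head 0%N [seq val j | j <- t]) * chain_wt q [seq val j | j <- t].

Lemma chain_sum0 q N W :
  chain_sum q 0 N W = \sum_(0 <= n < N.+1 | (0 < n)%N) W n * q ^+ (n ^ 2).
Proof.
rewrite /chain_sum (big_tuple_cons _
  (fun t : seq 'I_N.+1 => let s := [seq val j | j <- t] in
    sorted leq s && (0 < head 0 s)%N)
  (fun t : seq 'I_N.+1 =>
    W (head 0%N [seq val j | j <- t]) * chain_wt q [seq val j | j <- t])).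
rewrite big_mkord [RHS]big_mkcond /=; apply: eq_bigr => a _.
case: ifP => a0; last by rewrite big_pred0// => t; rewrite (tuple0 t).
rewrite (big_pred1 [tuple]) => [|t]; last by rewrite (tuple0 t) /= eqxx.
by rewrite /= /chain_wt /= big_seq1 big_ord0 divr1.
Qed.

Lemma chain_sumS q i N W : chain_sum q i.+1 N W =
  chain_sum q i N (fun n => \sum_(0 <= m < n.+1 | (0 < m)%N)
    W m * (q ^+ (m ^ 2) / qpoch q q (n - m))).
Proof.
rewrite /chain_sum (big_tuple_cons _
  (fun t : seq 'I_N.+1 => let s := [seq val j | j <- t] in
    sorted leq s && (0 < head 0 s)%N)
  (fun t : seq 'I_N.+1 =>
    W (head 0%N [seq val j | j <- t]) * chain_wt q [seq val j | j <- t])).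
under eq_bigr do rewrite big_mkcond /=.
rewrite exchange_big /= [RHS]big_mkcond /=; apply: eq_bigr => t _.
case/tupleP: t => b t /=; set s := [seq val j | j <- t].
case: ifP => [/andP[st b0]|h]; last first.
  apply: big1 => a _; case: ifP => // /andP[/andP[ab st] a0].
  by move: h; rewrite st (leq_trans a0 ab).
rewrite mulr_suml (big_nat_widen _ _ N.+1) ?ltn_ord// big_mkord.
rewrite [RHS]big_mkcond /=; apply: eq_bigr => a _.
rewrite st andbT ltnS andbC; case: ifP => // _.
by rewrite chain_wt_cons mulrA.
Qed.

(** Each use of [chain_sumS] absorbs the smallest index into the weight, turning [FGhead j] into
    [FGhead j.+1] and leaving j + i invariant. *)
Lemma chain_sum_FGhead w q i j N : chain_sum q i N (FGhead j w q) =
  series (FGlast (j + i) w q) N.+1.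
Proof.
elim: i j => [|i ih] j.
  rewrite chain_sum0 addn0 /series /= big_mkcond /=; apply: eq_bigr => n _.
  by case: n => // n; rewrite mulrC.
by rewrite chain_sumS addnS -addSn -ih.
Qed.

(** The largest of the k - 1 indices is the index of the series [FGw], which leaves k - 2 inner
    summations. *)
Lemma FG_FGw (k : nat) zeta q : (2 <= k)%N -> zeta != 0 ->
  nm q < 1 -> nm (zeta + zeta^-1 - 2) <= wrad (nm q) ->
  FG k zeta q = FGw (k - 2) (zeta + zeta^-1 - 2) q.
Proof.
case: k => [//|[//|k]] _ z0 q1 hw; rewrite subSS subSS subn0.
set w := zeta + zeta^-1 - 2 in hw *.
rewrite /FG.
have -> : (fun N => \sum_(t : k.+1.-tuple 'I_N.+1 |
            let s := [seq val i | i <- t] in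
            sorted leq s && (0 < head 0 s)%N)
      FG_term zeta q [seq val i | i <- t]) = fun N => series (FGlast k w q) N.+1.
  apply/funext => N; rewrite -[k in FGlast k]add0n -chain_sum_FGhead.
  apply: eq_bigr => t _; rewrite FGhead0_zeta// /FG_term /chain_wt.
  by rewrite -[X in _ / X]mulrA invfM mulrA [LHS]mulrC -[LHS]mulrA [LHS]mulrC.
apply: cvg_lim; first exact: norm_hausdorff.
have /cvg_nmP hl := @cvg_FGw _ k _ _ q1 hw; apply/cvg_nmP => e /hl[N hN].
by exists N => n hn; apply: hN; rewrite leqW.
Qed.

End FGIdentity.

(** * Taylor polynomials at the origin *)

Section Taylor.
Variable R : realType.
Implicit Types (u x : C R) (f g : C R -> C R) (p q r : {poly C R}).

(** The origin is excluded because the defining identity of the f_{k,j} is only given off z = 0. The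
    degree of [p] is free, so [p] is determined modulo u^N ([taylor_uniq], [taylor_coef]). *)
Definition taylor (N : nat) f p := exists K d : R, 0 < d /\
  forall u, u != 0 -> nm u < d -> nm (f u - p.[u]) <= K * nm u ^+ N.

Lemma poly_bound p : exists M, 0 <= M /\ forall u, nm u <= 1 -> nm p.[u] <= M.
Proof.
exists (\sum_(i < size p) nm p`_i); split.
  by apply: sumr_ge0 => i _; exact: nm_ge0.
move=> u u1; rewrite horner_coef (le_trans (nm_sum _ _ _))//.
by apply: ler_sum => i _; rewrite nmM nmX ler_piMr ?nm_ge0// exprn_ile1 ?nm_ge0.
Qed.

Lemma taylor_near N f g p (d : R) : 0 < d ->
  (forall u, u != 0 -> nm u < d -> f u = g u) -> taylor N f p -> taylor N g p.
Proof.
move=> d0 fg [K [e [e0 h]]]; exists K, (Num.min d e); split.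
  by rewrite lt_min d0.
by move=> u u0; rewrite lt_min => /andP[ud ue]; rewrite -fg// h.
Qed.

Lemma taylor_ext N f g p : f =1 g -> taylor N f p -> taylor N g p.
Proof. by move=> fg; apply: (@taylor_near _ _ _ _ 1) => // u _ _; rewrite fg. Qed.

Lemma taylor_poly N p : taylor N (fun u => p.[u]) p.
Proof. by exists 0, 1; split=> // u _ _; rewrite subrr nm0 mul0r. Qed.

Lemma taylorC N (c : C R) : taylor N (fun=> c) c%:P.
Proof. by apply: taylor_ext (taylor_poly N _) => u; rewrite hornerC. Qed.

Lemma taylorX N : taylor N (fun u => u) 'X.
Proof. by apply: taylor_ext (taylor_poly N _) => u; rewrite hornerX. Qed.

Lemma taylorD N f g p q : taylor N f p -> taylor N g q ->
  taylor N (fun u => f u + g u) (p + q).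
Proof.
move=> [K [d [d0 h]]] [L [e [e0 k]]]; exists (K + L), (Num.min d e); split.
  by rewrite lt_min d0.
move=> u u0; rewrite lt_min => /andP[ud ue]; rewrite hornerD.
have := lerD (h u u0 ud) (k u u0 ue); rewrite -mulrDl; apply: le_trans.
by rewrite opprD addrACA nmD.
Qed.

Lemma taylorM N f g p q : taylor N f p -> taylor N g q ->
  taylor N (fun u => f u * g u) (p * q).
Proof.
move=> [K [d [d0 h]]] [L [e [e0 k]]].
have [P [P0 hP]] := poly_bound p; have [Q [Q0 hQ]] := poly_bound q.
exists (K * (`|L| + Q) + P * L), (Num.min 1 (Num.min d e)); split.
  by rewrite !lt_min ltr01 d0.
move=> u u0; rewrite !lt_min => /and3P[/ltW u1 ud ue].
have {}h := h u u0 ud; have {}k := k u u0 ue.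
have {}hP := hP u u1; have {}hQ := hQ u u1.
have un0 : 0 <= nm u ^+ N by rewrite exprn_ge0 ?nm_ge0.
have un1 : nm u ^+ N <= 1 by rewrite exprn_ile1 ?nm_ge0.
have hg : nm (g u) <= `|L| + Q.
  rewrite -(subrK q.[u] (g u)) (le_trans (nmD _ _))// lerD// (le_trans k)//.
  by rewrite (le_trans (ler_wpM2r un0 (ler_norm L)))// ler_piMr.
rewrite hornerM (_ : _ - _ = (f u - p.[u]) * g u + p.[u] * (g u - q.[u])); last by ring.
rewrite (le_trans (nmD _ _))// !nmM mulrDl lerD//.
  by rewrite mulrAC ler_pM ?nm_ge0.
by rewrite -mulrA ler_pM ?nm_ge0.
Qed.

Lemma taylorE N f p n : taylor N f p -> taylor N (fun u => f u ^+ n) (p ^+ n).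
Proof.
move=> h; elim: n => [|n ih].
  by apply: taylor_ext (taylorC N 1) => u; rewrite expr0.
rewrite exprS; apply: taylor_ext (taylorM h ih) => u.
by rewrite exprS.
Qed.

Lemma taylor_sum N n (f : nat -> C R -> C R) (p : nat -> {poly C R}) :
  (forall i, taylor N (f i) (p i)) ->
  taylor N (fun u => \sum_(i < n) f i u) (\sum_(i < n) p i).
Proof.
move=> h; elim: n => [|n ih].
  by rewrite big_ord0; apply: taylor_ext (taylorC N 0) => u; rewrite big_ord0.
rewrite big_ord_recr; apply: taylor_ext (taylorD ih (h n)) => u.
by rewrite big_ord_recr.
Qed.

Lemma taylor_divX N f p :
  taylor N.+1 (fun u => f u * u) (p * 'X) -> taylor N f p.
Proof.
move=> [K [d [d0 h]]]; exists K, d; split=> // u u0 ud.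
have := h u u0 ud; rewrite hornerMX -mulrBl nmM exprSr mulrA.
by rewrite ler_pM2r// nm_gt0.
Qed.

Lemma small_pt (d : R) : 0 < d -> exists u, u != 0 /\ nm u < d.
Proof.
move=> d0; exists (Complex (d / 2) 0).
have e0 : 0 < d / 2 by rewrite divr_gt0.
rewrite -nm_gt0 nm_real gtr0_norm//; split=> //; lra.
Qed.

Lemma small_eq0 c (K d : R) : 0 < d ->
  (forall u, u != 0 -> nm u < d -> nm c <= K * nm u) -> c = 0 :> C R.
Proof.
move=> d0 h; apply/eqP; rewrite -nm_eq0; apply: contraT => c0.
have {}c0 : 0 < nm c by rewrite lt_def c0 nm_ge0.
have K0 : 0 < `|K| + 1 by rewrite ltr_wpDl.
have e0 : 0 < Num.min d (nm c / (`|K| + 1)) by rewrite lt_min d0 divr_gt0.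
have [u [u0]] := small_pt e0; rewrite lt_min ltr_pdivlMr// => /andP[ud].
have := h u u0 ud.
have := ler_norm K; have : 0 < nm u by rewrite nm_gt0.
nra.
Qed.

(** The constant term is O(u), hence 0; dividing by u then lowers N by one. *)
Lemma poly_small_coef N (K d : R) r : 0 < d ->
  (forall u, u != 0 -> nm u < d -> nm r.[u] <= K * nm u ^+ N) ->
  forall m, (m < N)%N -> r`_m = 0.
Proof.
move=> d0; elim: N r => [//|N ih]; elim/poly_ind => [|r c _] h m mN.
  by rewrite coef0.
have c0 : c = 0.
  have [M [M0 hM]] := poly_bound r.
  apply: (@small_eq0 c (`|K| + M) (Num.min 1 d)); first by rewrite lt_min ltr01.
  move=> u u0; rewrite lt_min => /andP[/ltW u1 ud].
  have {}h := h u u0 ud; rewrite hornerMXaddC in h.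
  rewrite (_ : c = (r.[u] * u + c) - r.[u] * u); last by ring.
  rewrite (le_trans (nmB _ _))// mulrDl lerD//.
    rewrite (le_trans h)// (le_trans (ler_wpM2r _ (ler_norm K))) ?exprn_ge0 ?nm_ge0//.
    by rewrite ler_wpM2l// exprS ler_piMr ?nm_ge0// exprn_ile1// nm_ge0.
  by rewrite nmM ler_wpM2r ?nm_ge0// hM.
rewrite coefD coefMX coefC c0; case: m mN => [|m] mN /=; first by rewrite addr0.
rewrite addr0; apply: ih => // u u0 ud.
have := h u u0 ud; rewrite hornerMXaddC c0 addr0 nmM exprSr mulrA.
by rewrite ler_pM2r// nm_gt0.
Qed.

Lemma taylor_uniq N f p q m : taylor N f p -> taylor N f q -> (m < N)%N ->
  p`_m = q`_m.
Proof.
move=> [K [d [d0 h]]] [L [e [e0 k]]] mN; apply/eqP; rewrite -subr_eq0 -coefB.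
apply/eqP; apply: (@poly_small_coef N (K + L) (Num.min d e)) mN.
  by rewrite lt_min d0.
move=> u u0; rewrite lt_min => /andP[ud ue].
rewrite mulrDl (le_trans _ (lerD (h u u0 ud) (k u u0 ue)))//.
by rewrite hornerD hornerN (nmBC (f u) p.[u]); exact: nm_tri.
Qed.

Lemma series_tail (c : nat -> C R) (S : C R) (M t : R) N : 0 <= t <= 1 / 2 ->
  (forall n, nm (c n) <= M * t ^+ n) -> series c @ \oo --> S ->
  nm (S - \sum_(n < N) c n) <= 2 * M * t ^+ N.
Proof.
move=> /andP[t0 t2] hc hS.
have M0 : 0 <= M by have := hc 0%N; rewrite expr0 mulr1; apply/le_trans/nm_ge0.
apply: nm_lim_le hS (cvg_cst _) _; exists N => n Nn.
rewrite -(big_mkord predT) /series /= (@big_cat_nat _ _ _ N)//= addrAC subrr add0r.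
rewrite (le_trans (nm_sum _ _ _))//.
rewrite (@le_trans _ _ (\sum_(N <= i < n) M * t ^+ i))//; first exact: ler_sum.
rewrite -mulr_sumr mulrAC mulrC ler_wpM2r// -{1}[N]add0n big_addn big_mkord.
under eq_bigr do rewrite exprD.
rewrite -mulr_suml ler_wpM2r ?exprn_ge0//.
rewrite (le_trans (sum_expr_le _ _))//.
  by rewrite t0; lra.
by rewrite -[leRHS]invrK lef_pV2 ?posrE; lra.
Qed.

(** Convergence at one point [v] bounds all a_n v^n by some [M]; for |u| < |v| / 2 the tail is
    dominated by a geometric series of ratio at most 1 / 2. *)
Lemma taylor_series (a : nat -> C R) f (d : R) N : 0 < d ->
  (forall u, u != 0 -> nm u < d ->
     series (fun n => a n * u ^+ n) @ \oo --> f u) ->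
  taylor N f (\sum_(n < N) a n *: 'X^n).
Proof.
move=> d0 h; have [v [v0 vd]] := small_pt d0.
have nv0 : 0 < nm v by rewrite nm_gt0.
have [M hM] : exists M, forall n, nm (a n * v ^+ n) <= M.
  have /cvg_nmP/(_ 1 ltr01)[n0 hn0] := h v v0 vd.
  set s := series _ in hn0.
  (* A term is the difference of two consecutive partial sums, both within 1 of the limit. *)
  have hb n : (n0 <= n)%N -> nm (a n * v ^+ n) <= 2.
    move=> hn; have -> : a n * v ^+ n = s n.+1 - s n.
      by rewrite /s seriesSr addrAC subrr add0r.
    have := hn0 n hn; have := hn0 n.+1 (leqW hn).
    have := nm_tri (f v) (s n.+1) (s n); rewrite (nmBC (f v)); lra.
  exists (2 + \sum_(i < n0) nm (a i * v ^+ i)) => n.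
  have s0 (P : pred 'I_n0) : 0 <= \sum_(i < n0 | P i) nm (a i * v ^+ i).
    by apply: sumr_ge0 => i _; exact: nm_ge0.
  have [nn|nn] := leqP n0 n; first by rewrite (le_trans (hb n nn))// lerDl.
  rewrite (bigD1 (Ordinal nn))//= addrCA lerDl addr_ge0//.
exists (2 * M / nm v ^+ N), (nm v / 2); split; first by rewrite divr_gt0.
move=> u u0 uv.
have ud : nm u < d by lra.
rewrite horner_sum.
under eq_bigr do rewrite hornerZ hornerXn.
rewrite mulrAC -mulrA -expr_div_n; apply: series_tail (h u u0 ud).
  rewrite divr_ge0 ?nm_ge0//= ler_pdivrMr//; lra.
move=> n; rewrite expr_div_n mulrA ler_pdivlMr ?exprn_gt0//.
rewrite -!nmX -nmM mulrAC nmM ler_wpM2r ?nm_ge0//.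
Qed.

End Taylor.

(** * The exponential function *)

Section Exponential.
Variable R : realType.
Implicit Types (u x y : C R) (f g : C R -> C R) (p q : {poly C R}).

Lemma cexpD x y : cexp (x + y) = cexp x * cexp y.
Proof.
case: x y => a b [c d]; rewrite /cexp /= expRD sinD cosD.
by apply/eqP; rewrite eq_complex /=; apply/andP; split; apply/eqP; ring.
Qed.

Lemma cexp0 : cexp 0 = 1 :> C R.
Proof. by rewrite /cexp /= expR0 cos0 sin0 mulr0 mul1r. Qed.

Lemma cexpN_mul x : cexp (- x) * cexp x = 1.
Proof. by rewrite -cexpD addNr cexp0. Qed.

Lemma cexp_neq0 x : cexp x != 0.
Proof.
by apply/eqP => h; have /eqP := cexpN_mul x; rewrite h mulr0 eq_sym oner_eq0.
Qed.

Lemma cexpV x : (cexp x)^-1 = cexp (- x).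
Proof. by apply: (mulIf (cexp_neq0 x)); rewrite mulVf ?cexp_neq0// cexpN_mul. Qed.

Lemma nm_cexp x : nm (cexp x) = expR (complex.Re x).
Proof.
apply/eqP; rewrite -(@eqrXn2 _ 2)// ?nm_ge0 ?expR_ge0// nm_sqr /=.
by rewrite !exprMn -mulrDr cos2Dsin2 mulr1.
Qed.

Lemma fact_neq0 (F : numFieldType) n : n`!%:R != 0 :> F.
Proof. by rewrite pnatr_eq0 -lt0n fact_gt0. Qed.

Lemma natrV_complex n : (n%:R^-1 : C R) = Complex n%:R^-1 0.
Proof.
have -> : (n%:R : C R) = Complex n%:R 0.
  exact: esym (rmorph_nat (real_complex R) n).
exact: esym (fmorphV (real_complex R) n%:R).
Qed.

(** The parity factors are those of [cos_coeff] and [sin_coeff], so that [cvg_cis] can match the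
    series term by term. *)
Lemma cis_expr (b : R) n : (Complex 0 b : C R) ^+ n =
  Complex ((~~ odd n)%:R * (-1) ^+ n./2 * b ^+ n)
          ((odd n)%:R * (-1) ^+ n.-1./2 * b ^+ n).
Proof.
elim: n => [|n ih].
  by apply/eqP; rewrite eq_complex /= !expr0 !mulr1 !eqxx.
rewrite exprS ih; apply/eqP; rewrite eq_complex /= !mul0r ?add0r ?sub0r !(exprS b).
apply/andP; split; apply/eqP.
  rewrite negbK; case: (boolP (odd n)) => on; last by rewrite /= !mul0r mulr0 oppr0.
  rewrite /= !mul1r; case: n on {ih} => // n /= /negbTE on.
  by rewrite (exprS (-1)); ring.
by case: (odd n) => /=; rewrite ?mul0r ?mulr0// !mul1r; ring.
Qed.

Lemma cvg_expR_complex (a : R) :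
  series (fun n => (Complex a 0 : C R) ^+ n / n`!%:R) @ \oo --> (Complex (expR a) 0 : C R).
Proof.
have h n : (Complex a 0 : C R) ^+ n / n`!%:R = Complex (a ^+ n / n`!%:R) 0.
  rewrite natrV_complex [X in X * _](esym (rmorphXn (real_complex R) n a)).
  exact: esym (rmorphM (real_complex R) (a ^+ n) n`!%:R^-1).
apply: cvg_ReIm => /=.
  rewrite [X in X @ _ --> _](_ : _ = series (exp_coeff a)).
    exact: is_cvg_series_exp_coeff.
  apply/funext => n; rewrite Re_series; congr (series _ n).
  by apply/funext => m; rewrite h.
rewrite [X in X @ _ --> _](_ : _ = cst 0); first exact: cvg_cst.
apply/funext => n; rewrite Im_series /series /= big1// => i _.
by rewrite h.
Qed.

Lemma cvg_cis (b : R) :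
  series (fun n => (Complex 0 b : C R) ^+ n / n`!%:R) @ \oo -->
  (Complex (cos b) (sin b) : C R).
Proof.
apply: cvg_ReIm => /=.
  rewrite [X in X @ _ --> _](_ : _ = series (cos_coeff b)).
    by rewrite unlock; exact: is_cvg_series_cos_coeff.
  apply/funext => n; rewrite Re_series; congr (series _ n).
  apply/funext => m; rewrite natrV_complex cis_expr /=.
  by rewrite mulr0 subr0.
rewrite [X in X @ _ --> _](_ : _ = series (sin_coeff b)).
  by rewrite unlock; exact: is_cvg_series_sin_coeff.
apply/funext => n; rewrite Im_series; congr (series _ n).
apply/funext => m; rewrite natrV_complex cis_expr /=.
by rewrite mulr0 add0r.
Qed.

Definition expsum N x : C R := \sum_(n < N) x ^+ n / n`!%:R.

Lemma exp_term_le x (t : R) n : nm x <= t -> nm (x ^+ n / n`!%:R) <= 1 * t ^+ n.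
Proof.
move=> xt; have t0 : 0 <= t := le_trans (nm_ge0 x) xt.
rewrite nmM nmX nmV nm_nat mulrC ler_pM ?invr_ge0 ?exprn_ge0 ?nm_ge0//.
  by rewrite invf_le1 ?ler1n ?fact_gt0// ltr0n fact_gt0.
by rewrite lerXn2r ?nnegrE ?nm_ge0.
Qed.

Lemma expsumD N x y : expsum N (x + y) =
  \sum_(r < N) \sum_(s < N - r) (x ^+ r / r`!%:R) * (y ^+ s / s`!%:R).
Proof.
rewrite -(sum_triangle (fun r s => (x ^+ r / r`!%:R) * (y ^+ s / s`!%:R))).
apply: eq_bigr => n _; rewrite addrC exprDn mulr_suml; apply: eq_bigr => i _.
have il : (i <= n)%N by rewrite -ltnS.
have := bin_fact il => /(congr1 (fun k => k%:R : C R)); rewrite !natrM => <-.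
rewrite -mulr_natr.
have b0 : 'C(n, i)%:R != 0 :> C R by rewrite pnatr_eq0 -lt0n bin_gt0.
have := fact_neq0 (C R) i; have := fact_neq0 (C R) (n - i) => h1 h2.
field.
by rewrite b0 h1 h2.
Qed.

(** The product runs over the square r, s < N and [expsumD] over the triangle r + s < N. What
    remains is at most N * N terms of size at most t^(r+s) <= t^N. *)
Lemma expsum_mul_le N x y (t : R) : nm x <= t -> nm y <= t -> t <= 1 ->
  nm (expsum N x * expsum N y - expsum N (x + y)) <= (N * N)%:R * t ^+ N.
Proof.
move=> xt yt t1; have t0 : 0 <= t := le_trans (nm_ge0 x) xt.
rewrite expsumD {1}/expsum mulr_suml -sumrB (le_trans (nm_sum _ _ _))//.
have -> : (N * N)%:R * t ^+ N = \sum_(r < N) N%:R * t ^+ N.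
  by rewrite sumr_const card_ord -[RHS]mulr_natl natrM mulrA.
apply: ler_sum => r _; rewrite mulr_sumr.
rewrite -!(big_mkord predT (fun s => (x ^+ r / r`!%:R) * (y ^+ s / s`!%:R))).
rewrite (@big_cat_nat _ _ _ (N - r) 0 N)//= ?leq_subr// addrAC subrr add0r.
rewrite (le_trans (nm_sum _ _ _))//.
have -> : N%:R * t ^+ N = \sum_(0 <= s < N) t ^+ N.
  by rewrite sumr_const_nat subn0 mulr_natl.
rewrite [leRHS](@big_cat_nat _ _ _ (N - r) 0 N)//= ?leq_subr//.
rewrite -[leLHS]add0r lerD//; first by apply: sumr_ge0 => s _; rewrite exprn_ge0.
rewrite [leLHS]big_nat_cond [leRHS]big_nat_cond; apply: ler_sum => s /andP[/andP[sN _] _].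
rewrite nmM (@le_trans _ _ ((1 * t ^+ r) * (1 * t ^+ s)))//.
  by rewrite ler_pM ?nm_ge0 ?exp_term_le.
rewrite !mul1r -exprD ler_wiXn2l//.
have := ltn_ord r; lia.
Qed.

(** [cexp] is built from real functions, so its series is first obtained on the two axes; e^a e^(ib)
    is then compared with the product of the two truncations. *)
Lemma cexp_tail N : exists K : R, forall x, nm x <= 1 / 2 ->
  nm (cexp x - expsum N x) <= K * nm x ^+ N.
Proof.
have half1 : (1 / 2 : R) <= 1 by lra.
(* In the notation below, |A - AN| |B| + |AN| |B - BN| is at most (2 * 2 + 4 * 2) t^N; the other
   summand comes from [expsum_mul_le]. *)
exists (12 + (N * N)%:R) => x hx; set t := nm x in hx *.
have t1 : t <= 1 := le_trans hx half1.
have t0 : 0 <= t by exact: nm_ge0.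
have t01 : 0 <= t <= 1 / 2 by rewrite t0.
case: x @t hx t1 t0 t01 => a b t hx t1 t0 t01.
pose A : C R := Complex (expR a) 0; pose B : C R := Complex (cos b) (sin b).
have eAB : cexp (Complex a b) = A * B.
  by apply/eqP; rewrite eq_complex /=; apply/andP; split; apply/eqP; ring.
have at_ : nm (Complex a 0 : C R) <= t by rewrite nm_real (Re_le_nm (Complex a b)).
have bt : nm (Complex 0 b : C R) <= t.
  rewrite (le_trans (nm_le_ReIm _))//= normr0 add0r.
  exact: (Im_le_nm (Complex a b)).
have hA n : nm (A - expsum n (Complex a 0)) <= 2 * 1 * t ^+ n.
  exact: (series_tail n t01 (fun m => exp_term_le m at_) (@cvg_expR_complex a)).
have hB n : nm (B - expsum n (Complex 0 b)) <= 2 * 1 * t ^+ n.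
  exact: (series_tail n t01 (fun m => exp_term_le m bt) (@cvg_cis b)).
have A2 : nm A <= 2 by have := hA 0%N; rewrite /expsum big_ord0 subr0 expr0 !mulr1.
have B2 : nm B <= 2 by have := hB 0%N; rewrite /expsum big_ord0 subr0 expr0 !mulr1.
have {}hA := hA N; have {}hB := hB N.
have hm := expsum_mul_le N at_ bt t1.
have eab : (Complex a 0 : C R) + Complex 0 b = Complex a b.
  by apply/eqP; rewrite eq_complex /= addr0 add0r !eqxx.
rewrite eab in hm; rewrite eAB.
set AN := expsum N (Complex a 0) in hA hm; set BN := expsum N (Complex 0 b) in hB hm.
have tN0 : 0 <= t ^+ N by rewrite exprn_ge0.
have tN1 : t ^+ N <= 1 by rewrite exprn_ile1.
have h2t : 2 * 1 * t ^+ N <= 2 by rewrite mulr1 ler_piMr.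
have AN4 : nm AN <= 4.
  rewrite -(subKr A AN) (le_trans (nmB _ _))//.
  by rewrite (le_trans (lerD A2 (le_trans hA h2t)))// -natrD.
have h1 : nm (A * B - AN * BN) <= 12 * t ^+ N.
  have -> : A * B - AN * BN = (A - AN) * B + AN * (B - BN) by ring.
  rewrite (le_trans (nmD _ _))// !nmM.
  apply: le_trans (lerD (ler_pM _ _ hA B2) (ler_pM _ _ AN4 hB)) _;
    rewrite ?nm_ge0//.
  by rewrite [leLHS](_ : _ = 12 * t ^+ N)//; ring.
rewrite mulrDl (le_trans (nm_tri (AN * BN) _ _))// lerD//.
Qed.

Definition expP N p : {poly C R} := \sum_(r < N) (r`!%:R^-1) *: p ^+ r.

Lemma taylor_linear N f p : p`_0 = 0 -> taylor N.+1 f p ->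
  exists L d : R, 0 < d /\ (0 <= L /\
    forall u, u != 0 -> nm u < d -> nm (f u) <= L * nm u).
Proof.
move=> p0 [K [e [e0 h]]].
have [p' pE] : exists p', p = p' * 'X.
  move: p0 {h}; elim/poly_ind: p => [_|p' c _]; first by exists 0; rewrite mul0r.
  rewrite coefD coefMX coefC /= add0r => ->.
  by exists p'; rewrite addr0.
have [M [M0 hM]] := poly_bound p'.
exists (`|K| + M), (Num.min 1 e); split; first by rewrite lt_min ltr01.
split; first by rewrite addr_ge0.
move=> u u0; rewrite lt_min => /andP[/ltW u1 ue].
rewrite -(subrK p.[u] (f u)) (le_trans (nmD _ _))// mulrDl lerD//.
  rewrite (le_trans (h u u0 ue))// (le_trans (ler_wpM2r _ (ler_norm K)))//.
    by rewrite exprn_ge0 ?nm_ge0.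
  by rewrite ler_wpM2l// exprS ler_piMr ?nm_ge0// exprn_ile1 ?nm_ge0.
by rewrite pE hornerMX nmM ler_wpM2r ?nm_ge0// hM.
Qed.

Lemma taylor_approx N f g p (K d : R) : 0 < d ->
  (forall u, u != 0 -> nm u < d -> nm (f u - g u) <= K * nm u ^+ N) ->
  taylor N g p -> taylor N f p.
Proof.
move=> d0 h [L [e [e0 k]]]; exists (K + L), (Num.min d e); split.
  by rewrite lt_min d0.
move=> u u0; rewrite lt_min => /andP[ud ue].
by rewrite (le_trans (nm_tri (g u) _ _))// mulrDl lerD ?h ?k.
Qed.

(** As p(0) = 0, f(u) = O(u) by [taylor_linear], so the remainder of the exponential series at f(u)
    is O(u^(N+1)). *)
Lemma taylor_exp N f p : p`_0 = 0 -> taylor N.+1 f p ->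
  taylor N.+1 (fun u => cexp (f u)) (expP N.+1 p).
Proof.
move=> p0 hf.
have hE : taylor N.+1 (fun u => expsum N.+1 (f u)) (expP N.+1 p).
  apply: (taylor_sum N.+1 (f := fun r u => f u ^+ r / r`!%:R)
    (p := fun r => r`!%:R^-1 *: p ^+ r)) => r.
  rewrite -mul_polyC mulrC; exact: taylorM (taylorE _ hf) (taylorC _ _).
have [L [d [d0 [L0 hL]]]] := taylor_linear p0 hf.
have [K hK] := cexp_tail N.+1.
have [K' [d' [d'0 h']]] := hE.
(* On this disc L |u| <= 1 / 2, the range of [cexp_tail]; L + 1 avoids a division by 0. *)
have d2 : 0 < 1 / (2 * (L + 1)) by rewrite divr_gt0// mulr_gt0// ltr_wpDl.
exists (`|K| * L ^+ N.+1 + K'), (Num.min (1 / (2 * (L + 1))) (Num.min d d')).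
split; first by rewrite !lt_min d2 d0.
move=> u u0; rewrite !lt_min => /and3P[u1 ud ud'].
have {}hL := hL u u0 ud.
have f2 : nm (f u) <= 1 / 2.
  move: u1; rewrite ltr_pdivlMr ?mulr_gt0 ?ltr_wpDl// => u1.
  have := nm_ge0 u; nra.
have := nm_tri (expsum N.+1 (f u)) (cexp (f u)) (expP N.+1 p).[u].
move/le_trans; apply; rewrite mulrDl lerD ?h'//.
rewrite (le_trans (hK _ f2))// -mulrA -exprMn.
rewrite (le_trans (ler_wpM2r _ (ler_norm K))) ?exprn_ge0 ?nm_ge0//.
by rewrite ler_wpM2l// lerXn2r ?nnegrE ?nm_ge0 ?mulr_ge0 ?nm_ge0.
Qed.

Lemma coef_exp_lt p m n : p`_0 = 0 -> (m < n)%N -> (p ^+ n)`_m = 0.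
Proof.
elim/poly_ind: p => [_|p' c _].
  by case: n => // n _; rewrite exprS mul0r coef0.
rewrite coefD coefMX coefC /= add0r => -> mn.
by rewrite addr0 exprMn coefMXn mn.
Qed.

Lemma expP_coef0 N p : p`_0 = 0 -> (expP N.+1 p)`_0 = 1.
Proof.
move=> p0; rewrite /expP coef_sum big_ord_recl /= big1 ?addr0.
  by rewrite coefZ expr0 coef1 mulr1 invr1.
by move=> i _; rewrite coefZ coef_exp_lt ?mulr0.
Qed.

Lemma deriv_expP N p : (expP N.+1 p)^`() = p^`() * expP N p.
Proof.
rewrite /expP raddf_sum /= big_ord_recl /= derivZ expr0 derivC scaler0 add0r.
rewrite mulr_sumr; apply: eq_bigr => i _; rewrite derivZ deriv_exp /=.
rewrite /bump /= add1n /= -scalerAr -[(_ * _) *+ _]scaler_nat scalerA; congr (_ *: _).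
by rewrite factS natrM invfM mulrAC mulVf ?mul1r.
Qed.

(** This is the coefficient of u^m in (e^p)' = p' e^p. Differentiation drops the term p^N / N!,
    which has no coefficient below u^N. *)
Lemma expP_rec N p m : p`_0 = 0 -> (m < N)%N ->
  (expP N.+1 p)`_m.+1 *+ m.+1 =
  \sum_(i < m.+1) (p`_i.+1 *+ i.+1) * (expP N.+1 p)`_(m - i).
Proof.
move=> p0 mN; rewrite -coef_deriv deriv_expP coefM; apply: eq_bigr => i _.
rewrite coef_deriv {2}/expP big_ord_recr /= coefD coefZ coef_exp_lt ?mulr0 ?addr0//.
by rewrite (leq_ltn_trans (leq_subr _ _)).
Qed.

(** The factor m + 1 can be cancelled, so the recurrence determines the sequence from its value 1 at
    0. A logarithm can thus be verified without being constructed. *)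
Lemma expP_unique N p (a : nat -> C R) : p`_0 = 0 -> a 0%N = 1 ->
  (forall m, (m < N)%N ->
    a m.+1 *+ m.+1 = \sum_(i < m.+1) (p`_i.+1 *+ i.+1) * a (m - i)%N) ->
  forall m, (m <= N)%N -> a m = (expP N.+1 p)`_m.
Proof.
move=> p0 a0 ha; elim/ltn_ind => -[|m] ih mN; first by rewrite a0 expP_coef0.
have m0 : m.+1%:R != 0 :> C R by rewrite pnatr_eq0.
apply: (mulfI m0); rewrite !mulr_natl ha// expP_rec//.
by apply: eq_bigr => i _; rewrite ih//; lia.
Qed.

Lemma taylor_coef N f p q : taylor N f p ->
  (forall m, (m < N)%N -> p`_m = q`_m) -> taylor N f q.
Proof.
move=> hp pq.
have [r hr] : exists r, q - p = r * 'X^N.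
  exists (drop_poly N (q - p)); rewrite -[LHS](poly_take_drop N).
  rewrite [take_poly _ _](_ : _ = 0) ?add0r//.
  apply/polyP => i; rewrite coef_take_poly coef0; case: ifP => // iN.
  by rewrite coefB pq// subrr.
have [M [M0 hM]] := poly_bound r.
have [K [d [d0 h]]] := hp.
exists (K + M), (Num.min 1 d); split; first by rewrite lt_min ltr01.
move=> u u0; rewrite lt_min => /andP[/ltW u1 ud].
have := nm_tri p.[u] (f u) q.[u]; move/le_trans; apply.
rewrite mulrDl lerD ?h// nmBC -hornerN -hornerD hr hornerM hornerXn nmM nmX.
by rewrite ler_wpM2r ?exprn_ge0 ?nm_ge0// hM.
Qed.

End Exponential.

(** * Bernoulli numbers and (e^u - 1) / u *)

Section Bernoulli.

Lemma size_bernoulli_seq n : size (bernoulli_seq n) = n.+1.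
Proof. by elim: n => //= n ih; rewrite size_rcons ih. Qed.

Lemma nth_bernoulli_seq n i : (i <= n)%N -> (bernoulli_seq n)`_i = bernoulli i.
Proof.
elim: n => [|n ih]; first by rewrite leqn0 => /eqP ->.
rewrite leq_eqVlt => /predU1P[->//|iltn].
by rewrite /= nth_rcons size_bernoulli_seq iltn ih.
Qed.

Lemma sum_bernoulli n : \sum_(i < n.+2) 'C(n.+2, i)%:R * bernoulli i = 0.
Proof.
rewrite big_ord_recr /= [bernoulli n.+1]/bernoulli /= nth_rcons.
rewrite size_bernoulli_seq ltnn eqxx.
have -> : 'C(n.+2, n.+1) = n.+2 by rewrite -bin_sub// subSnn bin1.
rewrite mulrC divfK ?pnatr_eq0// -sumrB big1// => i _.
by rewrite nth_bernoulli_seq ?subrr// -ltnS.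
Qed.

End Bernoulli.

Section ExpPolynomials.
Variable R : realType.
Implicit Types (p : {poly C R}).

Lemma expPZX M (a : C R) : expP M (a *: 'X) = \poly_(r < M) (a ^+ r / r`!%:R).
Proof.
rewrite poly_def; apply: eq_bigr => i _.
by rewrite exprZn scalerA mulrC.
Qed.

Lemma coef_expPZX M (a : C R) m :
  (expP M (a *: 'X))`_m = if (m < M)%N then a ^+ m / m`!%:R else 0.
Proof. by rewrite expPZX coef_poly. Qed.

Lemma taylor_cexpZ N (a : C R) :
  taylor N.+1 (fun u => cexp (a * u)) (expP N.+1 (a *: 'X)).
Proof.
apply: taylor_exp; first by rewrite coefZ coefX mulr0.
rewrite -mul_polyC; exact: taylorM (taylorC _ _) (taylorX _ _).
Qed.

Definition dexp_poly N : {poly C R} := \poly_(m < N.+1) (m.+1`!%:R^-1).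

(** Division by u costs one order of precision, hence the expansion of e^u - 1 to order N + 2. *)
Lemma taylor_dexp N : taylor N.+1 (fun u : C R => (cexp u - 1) / u) (dexp_poly N).
Proof.
apply: taylor_divX.
have h := taylorD (taylor_cexpZ N.+1 1) (taylorC N.+2 (-1)).
have h2 : taylor N.+2 (fun u : C R => (cexp u - 1) / u * u)
    (expP N.+2 (1 *: 'X) + (-1)%:P).
  apply: (@taylor_near _ _ _ _ _ 1) h => // u u0 _.
  by rewrite mul1r divfK.
apply: taylor_coef h2 _ => m mN.
rewrite expPZX coefD coefMX coefC !coef_poly mN expr1n mul1r.
case: m mN => [|m] /= mN; first by rewrite invr1 subrr.
by rewrite -ltnS mN addr0.
Qed.

Definition logdexp_poly N : {poly C R} :=
  \poly_(i < N.+1) (if i == 0%N then 0 else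
    ratr (bernoulli i) / i%:R / i`!%:R + (i == 1%N)%:R).

Lemma logdexp_poly0 N : (logdexp_poly N)`_0 = 0.
Proof. by rewrite coef_poly. Qed.

(** This is [sum_bernoulli] divided by (m + 2)!, with the term of B_0 moved to the right. *)
Lemma bernoulli_rec_complex m :
  \sum_(i < m.+1) (ratr (bernoulli i.+1) / i.+1`!%:R) / (m - i).+1`!%:R =
  - (m.+2`!%:R^-1) :> C R.
Proof.
have f0 : m.+2`!%:R != 0 :> C R := fact_neq0 _ _.
apply: (mulfI f0); rewrite mulrN divff// mulr_sumr.
have := congr1 (@ratr (C R)) (sum_bernoulli m).
rewrite raddf_sum /= big_ord_recl /= rmorph0 bin0 mul1r rmorph1 => /eqP.
rewrite addrC addr_eq0 => /eqP <-; apply: eq_bigr => i _.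
rewrite /bump /= add1n rmorphM /= ratr_nat.
have il : (i.+1 <= m.+2)%N by have := ltn_ord i; lia.
have := bin_fact il; rewrite subSS subSn -1?ltnS// => <-.
have cancel2 (x y c b : C R) : x != 0 -> y != 0 -> c * (x * y) * (b / x / y) = c * b.
  by move=> x0 y0; field; rewrite x0 y0.
by rewrite natrM (natrM _ i.+1`!); apply: cancel2; exact: fact_neq0.
Qed.

(** By [expP_unique] it suffices that the 1 / (m + 1)! satisfy G' = L' G for L = [logdexp_poly]. As
    L' has coefficients B_(i+1) / (i+1)! + [i = 0], this is the Bernoulli recurrence. *)
Lemma dexp_poly_exp N m : (m <= N)%N ->
  (dexp_poly N)`_m = (expP N.+1 (logdexp_poly N))`_m.
Proof.
move=> mN.
rewrite -(@expP_unique _ N _ (fun m => m.+1`!%:R^-1))//.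
- by rewrite coef_poly ltnS mN.
- exact: logdexp_poly0.
- by rewrite invr1.
move=> {mN} {}m mN.
under eq_bigr => i _.
  rewrite (_ : _ *+ i.+1 = ratr (bernoulli i.+1) / i.+1`!%:R + (i == 0%N :> nat)%:R).
    over.
  rewrite coef_poly ltnS (leq_trans (ltn_ord i) mN) /= eqSS -mulr_natr mulrDl.
  congr (_ + _); first by rewrite mulrAC divfK// pnatr_eq0.
  by case: (nat_of_ord i) => [|n]; rewrite ?mulr1// mul0r.
under eq_bigr do rewrite mulrDl.
rewrite big_split /= bernoulli_rec_complex big_ord_recl /= mul1r subn0.
rewrite big1 ?addr0 => [|i _]; last by rewrite mul0r.
have key (b c : C R) : b != 0 -> c + 1 != 0 ->
    ((c + 1) * b)^-1 * c = - ((c + 1) * b)^-1 + b^-1.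
  by move=> b0 c0; field; rewrite b0 c0.
rewrite -[LHS]mulr_natr (factS m.+1) natrM -[m.+2]addn1 natrD; apply: key.
  exact: fact_neq0.
by rewrite natr1 pnatr_eq0.
Qed.

End ExpPolynomials.

(** * Coefficients in w and evenness *)

Section Coefficients.
Variable R : realType.
Implicit Types (w q : C R).

(** [gam l] collects the coefficients of w^l, which [pnorm_coef] bounds at the cost of [wrad]^l. The
    remainder after L terms is estimated by [ev_tail] for each power of q and then summed. *)
Lemma wq_coefficients (Phi : C R -> C R -> C R) K : wq_series Phi K ->
  exists gam : nat -> C R -> C R,
    (forall l, exists K', wq_series (fun _ q => gam l q) K') /\
    (forall q, nm q < 1 -> forall L, exists M : R, forall w, nm w <= wrad (nm q) ->
      nm (Phi w q - \sum_(l < L) gam l q * w ^+ l) <= M * nm w ^+ L).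
Proof.
move=> [c hc].
pose a l q n : C R := ((c n)`_l)%:~R * q ^+ n.
pose gam l q := limn (series (a l q)).
have ha l q N : nm q < 1 ->
    \sum_(n < N) `|(c n)`_l|%:~R * nm q ^+ n <= K (nm q) / wrad (nm q) ^+ l.
  move=> q1; have [h1 _] := hc q q1.
  rewrite ler_pdivlMr ?exprn_gt0 ?wrad_gt0// (le_trans _ (h1 N))// mulr_suml.
  apply: ler_sum => n _; rewrite mulrAC ler_wpM2r ?exprn_ge0 ?nm_ge0//.
  exact: (pnorm_coef (wrad_ge0 _)).
have hcv l q : nm q < 1 -> series (a l q) @ \oo --> gam l q.
  move=> q1; have [g hg] : exists g : C R, series (a l q) @ \oo --> g.
    apply: (@cvg_series_nm _ _ (fun n => `|(c n)`_l|%:~R * nm q ^+ n)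
      (K (nm q) / wrad (nm q) ^+ l)) => n.
      by rewrite nmM nmX nm_int intr_norm.
    by rewrite /series /= big_mkord; exact: ha.
  exact: cvgP hg.
exists gam; split.
  move=> l; exists (fun r => K r / wrad r ^+ l); exists (fun n => ((c n)`_l)%:P).
  move=> q q1; split=> [N|w hw].
    under eq_bigr do rewrite pnormC; exact: ha.
  rewrite (_ : (fun n => _) = a l q); first exact: hcv.
  by apply/funext => n; rewrite evC.
move=> q q1 L; have [h1 h2] := hc q q1; have e0 := wrad_gt0 q1.
exists (K (nm q) / wrad (nm q) ^+ L) => w hw.
have hS : (fun n => \sum_(l < L) series (a l q) n * w ^+ l) @ \oo -->
    (\sum_(l < L) gam l q * w ^+ l).
  elim: L => [|L ih].
    rewrite big_ord0; under eq_fun do rewrite big_ord0.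
    exact: cvg_cst.
  rewrite big_ord_recr /=; under eq_fun do rewrite big_ord_recr /=.
  exact: cvgD ih (cvgM (hcv L q q1) (cvg_cst (w ^+ L))).
apply: nm_lim_le (h2 w hw) hS _; exists 0%N => N _.
rewrite /series /= big_mkord.
under [X in _ - X]eq_bigr do rewrite big_mkord mulr_suml.
rewrite exchange_big /= -sumrB (le_trans (nm_sum _ _ _))//.
have -> : K (nm q) / wrad (nm q) ^+ L * nm w ^+ L =
    (nm w / wrad (nm q)) ^+ L * K (nm q).
  by rewrite (expr_div_n (nm w)) [RHS]mulrC mulrA [RHS]mulrAC.
apply: le_trans (ler_wpM2l _ (h1 N)); last first.
  by rewrite exprn_ge0// divr_ge0 ?nm_ge0// ltW.
rewrite mulr_sumr; apply: ler_sum => n _.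
have -> : ev w (c n) * q ^+ n - \sum_(i < L) a i q n * w ^+ i =
    (ev w (c n) - \sum_(i < L) ((c n)`_i)%:~R * w ^+ i) * q ^+ n.
  rewrite mulrBl mulr_suml; congr (_ - _); apply: eq_bigr => i _.
  by rewrite /a mulrAC.
rewrite nmM nmX mulrA ler_wpM2r ?exprn_ge0 ?nm_ge0//.
exact: ev_tail.
Qed.

Definition wpoly N : {poly C R} :=
  expP N.+1 (1 *: 'X) + expP N.+1 ((-1) *: 'X) + (- 2)%:P.

Lemma taylor_wpoly N : taylor N.+1 (fun u : C R => cexp u + cexp (- u) - 2) (wpoly N).
Proof.
apply: taylor_ext (taylorD (taylorD (taylor_cexpZ N 1) (taylor_cexpZ N (-1)))
  (taylorC _ (- 2))) => u.
by rewrite mul1r mulN1r.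
Qed.

(** Even coefficients in the normalisation sum h_m u^m / m! of Hurwitz series, where products become
    binomial convolutions and so preserve integrality. *)
Definition even_hurwitz (p : {poly C R}) :=
  forall m, exists n : int, p`_m * m`!%:R = (2 * n)%:~R.

Lemma even_wpoly N : even_hurwitz (wpoly N).
Proof.
move=> m; rewrite /wpoly coefD coefD coefC (coef_expPZX _ 1) (coef_expPZX _ (-1)).
case: ltnP => mN; last first.
  by exists 0; case: m mN => // m _; rewrite !addr0 mul0r mulr0.
case: m mN => [|m] mN.
  by exists 0; rewrite /= !expr0 invr1 !mul1r mulr1 mulr0 mulr0z; ring.
(* The two exponentials contribute 1 + (-1)^(m+1), which is 2 or 0. *)
exists (~~ odd m.+1)%:Z; rewrite addr0 -mulrDl divfK ?fact_neq0//.
rewrite expr1n -signr_odd; case: (odd m.+1) => /=.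
  by rewrite expr1 subrr mulr0.
by rewrite expr0 mulr1 [RHS]mulrz_nat.
Qed.

Lemma even_hurwitzM p1 p2 : even_hurwitz p1 -> even_hurwitz p2 ->
  even_hurwitz (p1 * p2).
Proof.
move=> /choice[a ha] /choice[b hb] m.
exists (\sum_(i < m.+1) 2 * a i * b (m - i)%N * 'C(m, i)%:Z).
rewrite coefM mulr_suml mulr_sumr rmorph_sum /=; apply: eq_bigr => i _.
have il : (i <= m)%N by rewrite -ltnS.
have -> : p1`_i * p2`_(m - i) * m`!%:R =
    (p1`_i * i`!%:R) * (p2`_(m - i) * (m - i)`!%:R) * 'C(m, i)%:R.
  rewrite -(bin_fact il) natrM (natrM _ i`!).
  move: (i`!%:R : C R) ((m - i)`!%:R : C R) ('C(m, i)%:R : C R) => x y z; ring.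
by rewrite ha hb !intrM -pmulrn; ring.
Qed.

Lemma even_hurwitzX p l : even_hurwitz p -> even_hurwitz (p ^+ l.+1).
Proof.
move=> h; elim: l => [|l ih]; first by rewrite expr1.
by rewrite exprS; exact: even_hurwitzM.
Qed.

(** The index starts at 1 because the constant coefficient of w^0 is odd. *)
Lemma wpolyX_hurwitz N l m : exists n : int,
  (wpoly N ^+ l)`_m.+1 * m.+1`!%:R = (2 * n)%:~R.
Proof.
case: l => [|l]; last exact: even_hurwitzX (even_wpoly N) _.
by exists 0; rewrite expr0 coef1 mul0r mulr0.
Qed.

End Coefficients.

(** * Comparison of Taylor coefficients *)

Section Core.
Variable R : realType.
Implicit Types (w q u z tau : C R).

Lemma dnbhs_nm (P : C R -> Prop) : (\forall z \near (0 : C R)^', P z) ->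
  exists d : R, 0 < d /\ forall z, z != 0 -> nm z < d -> P z.
Proof.
rewrite near_withinE => /nbhs_ballP[e e0 he].
have er : 0 < complex.Re e by move: e0; rewrite /= ltcE /= => /andP[].
exists (complex.Re e); split=> // z z0 ze; apply: he => //.
rewrite /ball /= sub0r normrN nmE ltcE /= ze andbT.
by move: e0; rewrite /= ltcE /= => /andP[].
Qed.

Lemma cpi_neq0 : cpi R != 0.
Proof. by rewrite -nm_gt0 nm_real gtr0_norm ?pi_gt0. Qed.

Lemma cI_neq0 : cI R != 0.
Proof.
apply/eqP => /(congr1 (@complex.Im R)) /= /eqP.
by rewrite oner_eq0.
Qed.

Lemma nm_e2pi tau : upper_half_plane tau -> nm (e2pi tau) < 1.
Proof.
rewrite /upper_half_plane /= => t0; rewrite /e2pi nm_cexp -expR0 ltr_expR.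
have -> : (2 : C R) = Complex 2 0 := esym (rmorph_nat (real_complex R) 2).
case: tau t0 => a b /= b0.
rewrite [X in X < _](_ : _ = - (2 * pi * b)); last by ring.
by rewrite oppr_lt0 mulr_gt0// mulr_gt0// pi_gt0.
Qed.

Lemma wpoly0 N : (wpoly R N)`_0 = 0.
Proof.
rewrite /wpoly coefD coefD coefC (coef_expPZX _ 1) (coef_expPZX _ (-1)) /=.
by rewrite !expr0 invr1 mul1r; ring.
Qed.

(* p is the Taylor polynomial of log F. *)
Lemma FG_taylor (k N : nat) (f : nat -> C R -> C R) (gam : nat -> C R -> C R)
    tau (M : R) :
  (2 <= k)%N -> is_FG_coefs k f -> upper_half_plane tau ->
  (forall w, nm w <= wrad (nm (e2pi tau)) ->
     nm (qpoch_inf (e2pi tau) (e2pi tau) * FGw (k - 2) w (e2pi tau) -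
         \sum_(l < N.+1) gam l (e2pi tau) * w ^+ l) <= M * nm w ^+ N.+1) ->
  exists p : {poly C R},
    [/\ p`_0 = 0,
        forall i, (i < N)%N -> p`_i.+1 * i.+1`!%:R =
          2 * f i.+1 tau + ratr (bernoulli i.+1) / i.+1%:R + (i == 0%N)%:R / 2 &
        forall m, (m <= N)%N ->
          (\sum_(l < N.+1) gam l (e2pi tau) *: wpoly R N ^+ l +
             (theta 1 (2 * k%:Z - 1) tau)%:P)`_m = (expP N.+1 p)`_m].
Proof.
move=> k2 hf htau hM; have q1 := nm_e2pi htau.
set q := e2pi tau in hM q1 *; set th := theta _ _ _.
pose Q := qpoch_inf q q; have Q0 : Q != 0 := qpoch_inf_neq0 q1.
have [d [d0 hd]] := dnbhs_nm (hf tau htau).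
have pi0 := cpi_neq0; have I0 := cI_neq0.
pose c0 : C R := 2 * cpi R * cI R.
have c00 : c0 != 0 by rewrite !mulf_neq0// pnatr_eq0.
pose s z j := f j.+1 tau * (c0 * z) ^+ j.+1 / (j.+1)`!%:R.
pose S u := limn (series (s (u / c0))).
pose D := d * nm c0; have D0 : 0 < D by rewrite mulr_gt0// nm_gt0.
have hD u : u != 0 -> nm u < D -> u / c0 != 0 /\ nm (u / c0) < d.
  move=> u0 uD; split; first by rewrite mulf_neq0 ?invr_eq0.
  by rewrite nmM nmV ltr_pdivrMr// nm_gt0.
have hS u : u != 0 -> nm u < D -> series (s (u / c0)) @ \oo --> S u.
  move=> u0 uD; have [z0 zd] := hD u u0 uD; have [T hT _] := hd _ z0 zd.
  exact: cvgP hT.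
have hid u : u != 0 -> nm u < D ->
    FG k (e2pi (u / c0)) q + th / Q =
    csin (cpi R * (u / c0)) / (cpi R * (u / c0) * Q) * cexp (2 * S u).
  move=> u0 uD; have [z0 zd] := hD u u0 uD; have [T hT ->] := hd _ z0 zd.
  by rewrite (cvg_Cunique (hS u u0 uD) hT).
pose a n : C R := if n is n'.+1 then f n tau / n`!%:R else 0.
pose pS : {poly C R} := \sum_(n < N.+1) a n *: 'X^n.
have tS : taylor N.+1 S pS.
  apply: (taylor_series N.+1 D0) => u u0 uD.
  have /cvg_nmP h := hS u u0 uD; apply/cvg_nmP => e /h[n0 hn0].
  exists n0.+1 => -[//|n] hn; rewrite (_ : series _ _ = series (s (u / c0)) n).
    exact: hn0.
  rewrite /series /= big_nat_recl//= mul0r add0r; apply: eq_bigr => i _.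
  by rewrite /s /a mulrCA divff// mulr1 mulrAC.
have pS0 : pS`_0 = 0 by rewrite coef_sum big1// => -[[|i] ?] _;
  rewrite coefZ coefXn ?mul0r ?mulr0.
pose W u : C R := cexp u + cexp (- u) - 2.
pose F u := Q * FG k (e2pi (u / c0)) q + th.
have tF : taylor N.+1 F (\sum_(l < N.+1) gam l q *: wpoly R N ^+ l + th%:P).
  apply: taylorD; last exact: taylorC.
  have tW := taylor_wpoly R N.
  have [L [e [e0 [L0 hL]]]] := taylor_linear (wpoly0 N) tW.
  have r0 := wrad_gt0 q1.
  (* For |u| below this bound, |W u| <= L |u| stays in the disc where the expansion in w holds. *)
  have b0 : 0 < wrad (nm q) / (L + 1) by rewrite divr_gt0// ltr_wpDl.
  apply: (@taylor_approx _ N.+1 _ (fun u => \sum_(l < N.+1) gam l q * W u ^+ l) _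
    (`|M| * L ^+ N.+1) (Num.min e (wrad (nm q) / (L + 1)))).
  - by rewrite lt_min e0.
  - move=> u u0; rewrite lt_min ltr_pdivlMr ?ltr_wpDl// => /andP[ue ur].
    have {}hL := hL u u0 ue; rewrite -/(W u) in hL.
    have Wr : nm (W u) <= wrad (nm q).
      rewrite (le_trans hL)// (le_trans _ (ltW ur))// mulrC ler_wpM2l ?nm_ge0//.
      by rewrite lerDl.
    have ez : e2pi (u / c0) = cexp u by rewrite /e2pi -/c0 mulrCA divff// mulr1.
    rewrite ez FG_FGw ?cexp_neq0// ?cexpV -/(W u)//.
    rewrite (le_trans (hM _ Wr))// (le_trans (ler_wpM2r _ (ler_norm M)))//.
      by rewrite exprn_ge0 ?nm_ge0.
    rewrite -mulrA -exprMn ler_wpM2l// lerXn2r ?nnegrE ?nm_ge0//.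
    by rewrite mulr_ge0 ?nm_ge0.
  - apply: (@taylor_sum _ _ _ (fun l u => gam l q * W u ^+ l)
      (fun l => gam l q *: wpoly R N ^+ l)) => l.
    by rewrite -mul_polyC; apply: taylorM (taylorC _ _) (taylorE _ tW).
(* Since pi z = u / (2 i), sin (pi z) / (pi z) equals e^(-u/2) (e^u - 1) / u. *)
have FE u : u != 0 -> nm u < D ->
    (cexp u - 1) / u * cexp (- (1 / 2) * u) * cexp (2 * S u) = F u.
  move=> u0 uD; rewrite /F.
  have -> : th = Q * (th / Q) by rewrite mulrCA divff// mulr1.
  rewrite -mulrDr hid// mulrA; congr (_ * _).
  have e1 : cI R * (cpi R * (u / c0)) = u / 2.
    by rewrite /c0; field; rewrite pi0 I0.
  have e2 : - (1 / 2) * u = - (u / 2) by field.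
  have e3 : cpi R * (u / c0) = u / (2 * cI R).
    by rewrite /c0; field; rewrite pi0 I0.
  rewrite /csin e1 e2 e3 -cexpV.
  have -> : cexp u = cexp (u / 2) * cexp (u / 2).
    by rewrite -cexpD; congr cexp; field.
  have E0 := cexp_neq0 (u / 2); move: (cexp _) E0 => E E0.
  by field; rewrite I0 u0 E0 Q0.
pose pd := logdexp_poly R N.
have tD : taylor N.+1 (fun u : C R => (cexp u - 1) / u) (expP N.+1 pd).
  by apply: taylor_coef (taylor_dexp R N) _ => m mN; exact: dexp_poly_exp.
have t2S : taylor N.+1 (fun u => 2 * S u) (2%:P * pS).
  by apply: taylorM (taylorC _ _) tS.
have p2S0 : (2%:P * pS)`_0 = 0 by rewrite coefCM pS0 mulr0.
have tF2 : taylor N.+1 F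
    (expP N.+1 pd * expP N.+1 (- (1 / 2) *: 'X) * expP N.+1 (2%:P * pS)).
  apply: taylor_near D0 FE _.
  exact: taylorM (taylorM tD (taylor_cexpZ _ _)) (taylor_exp p2S0 t2S).
(* The summand - u / 2 cancels half of the extra u in [logdexp_poly], whence [i = 0] / 2 in the
   conclusion. *)
pose p := pd + - (1 / 2) *: 'X + 2%:P * pS.
have pd0 := logdexp_poly0 R N.
have p0 : p`_0 = 0.
  by rewrite !coefD p2S0 -/pd pd0 coefZ coefX mulr0 !addr0.
have tp : taylor N.+1 (fun u => pd.[u] + - (1 / 2) * u + 2 * S u) p.
  apply: taylorD t2S; apply: taylorD; first exact: taylor_poly.
  by rewrite -mul_polyC; exact: taylorM (taylorC _ _) (taylorX _ _).
have tp1 := taylor_exp p0 tp.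
(* The functional equation is needed for truncated exponentials only modulo u^(N+1). It is read off
   from [cexpD]: both sides are Taylor polynomials of the same function. *)
have tp2 : taylor N.+1 (fun u => cexp (pd.[u] + - (1 / 2) * u + 2 * S u))
    (expP N.+1 pd * expP N.+1 (- (1 / 2) *: 'X) * expP N.+1 (2%:P * pS)).
  apply: taylor_ext (taylorM (taylorM (taylor_exp pd0 (taylor_poly _ _))
    (taylor_cexpZ _ _)) (taylor_exp p2S0 t2S)) => u /=.
  by rewrite !cexpD.
exists p; split=> // [i iN|m mN]; last first.
  by rewrite (taylor_uniq tF tF2)// (taylor_uniq tp2 tp1).
rewrite !coefD coefCM coefZ coefX coef_sum coef_poly ltnS iN /= eqSS.
rewrite (bigD1 (Ordinal (iN : (i.+1 < N.+1)%N)))//= big1 ?addr0; last first.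
  move=> j ji; rewrite coefZ coefXn eq_sym; case: eqP; rewrite ?mulr0// => e.
  by case/eqP: ji; apply: val_inj.
rewrite coefZ coefXn eqxx mulr1.
have key (b g c e : C R) : c != 0 -> e * c = e ->
    (b / c + e + - (1 / 2) * e + 2 * (g / c)) * c = 2 * g + b + e / 2.
  move=> c1 ec.
  rewrite [LHS](_ : _ = b + e * c - (1 / 2) * (e * c) + 2 * g); last by field.
  by rewrite ec; field.
apply: key; first exact: fact_neq0.
by case: (i) => [|n] /=; rewrite ?mulr1// mul0r.
Qed.

End Core.

(** * Integral series in q and the recurrence for the logarithm *)

Section IntegralQSeries.
Variable R : realType.

(** Z[[q]] realised by convergent functions on |q| < 1, viewed as [wq_series] constant in w so that
    the closure lemmas apply. *)
Definition int_qseries (g : C R -> C R) := exists K, wq_series (fun _ q => g q) K.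

Lemma int_qseriesD g h : int_qseries g -> int_qseries h ->
  int_qseries (fun q => g q + h q).
Proof. by move=> [K hK] [L hL]; eexists; exact: wqD hK hL. Qed.

Lemma int_qseriesM g h : int_qseries g -> int_qseries h ->
  int_qseries (fun q => g q * h q).
Proof. by move=> [K hK] [L hL]; eexists; exact: wqM hK hL. Qed.

Lemma int_qseries_int (n : int) : int_qseries (fun=> n%:~R).
Proof. by eexists; exact: wq_int. Qed.

Lemma int_qseries_ext g h : (forall q, g q = h q) -> int_qseries g -> int_qseries h.
Proof. by move=> /funext ->. Qed.

Lemma int_qseries_sum n (F : nat -> C R -> C R) :
  (forall i, (i < n)%N -> int_qseries (F i)) ->
  int_qseries (fun q => \sum_(i < n) F i q).
Proof.
elim: n => [|n ih] hF.
  by apply: int_qseries_ext (int_qseries_int 0) => q; rewrite big_ord0.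
have h := int_qseriesD (ih (fun i hi => hF i (ltnW hi))) (hF n (ltnSn n)).
by apply: int_qseries_ext h => q; rewrite big_ord_recr.
Qed.

(** The coefficients in Z[w] may still involve w although the sum does not; evaluation at w = 0
    selects integers. *)
Lemma int_qseries_coef g : int_qseries g -> exists a : nat -> int,
  forall q, nm q < 1 -> series (fun n => (a n)%:~R * q ^+ n) @ \oo --> g q.
Proof.
move=> [K [c hc]]; exists (fun n => (c n)`_0) => q q1.
have [_ /(_ 0)] := hc q q1; rewrite nm0 => /(_ (wrad_ge0 _)).
rewrite (_ : (fun n => _) = (fun n => ((c n)`_0)%:~R * q ^+ n))//.
by apply/funext => n; rewrite /ev horner_coef0 coef_map.
Qed.

(** [psi] and [Phi] are halves of Hurwitz coefficients of log F and F, with index shifted by one. In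
    F' = (log F)' F the last summand isolates [psi m] since F(0) = 1, and halving turns the product
    of two factors 2 into the single 2 before the binomial. *)
Lemma hurwitz_log_rec N (p : {poly C R}) (psi Phi : nat -> C R) :
  p`_0 = 0 -> (forall i, (i < N)%N -> p`_i.+1 * i.+1`!%:R = 2 * psi i) ->
  (forall m, (m < N)%N -> (expP N.+1 p)`_m.+1 * m.+1`!%:R = 2 * Phi m) ->
  forall m, (m < N)%N -> psi m =
    Phi m + \sum_(i < m) (- (2 * 'C(m, i))%:Z)%:~R * (psi i * Phi (m - i.+1)%N).
Proof.
move=> p0 hp hE m mN.
have two0 : (2 : C R) != 0 by rewrite pnatr_eq0.
have h := expP_rec p0 mN.
have hpi i : (i < N)%N -> p`_i.+1 *+ i.+1 = 2 * psi i / i`!%:R.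
  move=> iN; rewrite -hp// factS natrM mulrA mulfK ?fact_neq0//.
  by rewrite mulr_natr.
apply: (mulfI two0); rewrite mulrDr -(hE m)// factS natrM [X in X + _]mulrA
  (mulr_natr (expP N.+1 p)`_m.+1) h.
rewrite mulr_suml big_ord_recr /= subnn expP_coef0// mulr1 hpi//.
rewrite divfK ?fact_neq0// [X in X + _]addrC -addrA mulr_sumr -big_split /=.
rewrite big1 ?addr0//.
move=> i _; have im : (i < m)%N := ltn_ord i.
rewrite hpi; last exact: ltn_trans mN.
have hm : (expP N.+1 p)`_(m - i) = 2 * Phi (m - i.+1)%N / (m - i)`!%:R.
  rewrite -hE; last by lia.
  by rewrite -subSn// subSS mulfK ?fact_neq0.
rewrite hm -(bin_fact (ltnW im)) natrM (natrM _ i`!) rmorphN /= -pmulrn.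
rewrite (natrM _ 2).
have key (x y a b c : C R) : x != 0 -> y != 0 ->
    2 * a / x * (2 * b / y) * (c * (x * y)) + 2 * (- (2 * c) * (a * b)) = 0.
  by move=> x0 y0; field; rewrite x0 y0.
by apply: key; exact: fact_neq0.
Qed.

End IntegralQSeries.

(* For j = 1 the constant coefficient is excepted: f_{k,1} = 0 by the symmetry
   z |-> - z, so that coefficient is B_1 / 2 = - 1 / 4. *)
Theorem theorem1p6 (R : realType) (k j : nat) (f : nat -> C R -> C R)
    (hk : (3 <= k)%N) (hj : (1 <= j)%N) (hf : is_FG_coefs k f) :
  exists2 c : nat -> C R,
    fourier_expansion
      (fun tau : C R => f j tau + ratr (bernoulli j) / (2 * j)%N%:R) c
  & forall n : nat, (j, n) <> (1%N, 0%N) -> exists m : int, c n = m%:~R.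
Proof.
have k2 : (2 <= k)%N := ltnW hk.
have [gam [hgam hM]] := wq_coefficients (wqM (wq_qpoch_inf R) (wq_FGw R (k - 2))).
have /choice[hh hhP] : forall l, exists h : nat -> int, forall m,
    (wpoly R j ^+ l)`_m.+1 * m.+1`!%:R = (2 * h m)%:~R.
  by move=> l; have [h hP] := choice (wpolyX_hurwitz R j l); exists h.
(* Half of the Hurwitz coefficient of u^(m+1) in F; theta is constant in u and enters only at
   u^0. *)
pose Phi m q := \sum_(l < j.+1) gam l q * (hh l m)%:~R.
(* Half of the Hurwitz coefficient of u^(m+1) in log F; 1 / 4 is half of the [i = 0] / 2 in
   [FG_taylor]. *)
pose psi m tau := f m.+1 tau + ratr (bernoulli m.+1) / (2 * m.+1)%N%:R +
  (m == 0%N)%:R / 4.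
have hPhi m : int_qseries (Phi m).
  apply: (int_qseries_sum (F := fun l q => gam l q * (hh l m)%:~R)) => l _.
  exact: int_qseriesM (hgam l) (int_qseries_int _ _).
have rec tau m : upper_half_plane tau -> (m < j)%N -> psi m tau =
    Phi m (e2pi tau) + \sum_(i < m) (- (2 * 'C(m, i))%:Z)%:~R *
      (psi i tau * Phi (m - i.+1)%N (e2pi tau)).
  move=> htau; have q1 := nm_e2pi htau.
  have [M hMq] := hM _ q1 j.+1.
  have [p [p0 hp hE]] := FG_taylor k2 hf htau hMq.
  apply: (hurwitz_log_rec p0 (psi := psi^~ tau) (Phi := Phi^~ (e2pi tau))).
    move=> i ij; rewrite hp// /psi natrM !mulrDr; congr (_ + _ + _).
      by field; rewrite nat1r pnatr_eq0.
    by field.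
  move=> n nj; rewrite -hE// coefD coefC /= addr0 coef_sum mulr_suml mulr_sumr.
  apply: eq_bigr => l _; rewrite coefZ -mulrA hhP intrM; ring.
(* The recurrence [rec] holds for each tau separately; its right-hand side, read in q, defines one
   function for all tau. *)
have hpsi m : (m < j)%N -> exists g, int_qseries g /\
    forall tau, upper_half_plane tau -> psi m tau = g (e2pi tau).
  elim/ltn_ind: m => m ih mj.
  have /choice[G hG] : forall i, exists g, (i < m)%N -> int_qseries g /\
      forall tau, upper_half_plane tau -> psi i tau = g (e2pi tau).
    move=> i; have [im|im] := boolP (i < m)%N; last by exists (fun=> 0).
    by have [g hg] := ih i im (ltn_trans im mj); exists g.
  exists (fun q => Phi m q + \sum_(i < m) (- (2 * 'C(m, i))%:Z)%:~R *
    (G i q * Phi (m - i.+1)%N q)); split.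
    apply: int_qseriesD (hPhi m) _.
    apply: (int_qseries_sum (F := fun i q => (- (2 * 'C(m, i))%:Z)%:~R *
      (G i q * Phi (m - i.+1)%N q))) => i im.
    apply: int_qseriesM (int_qseries_int _ _) _.
    by apply: int_qseriesM (hPhi _); case: (hG i im).
  move=> tau htau; rewrite rec//; congr (_ + _); apply: eq_bigr => i _.
  by have [_ ->] := hG i (ltn_ord i).
have [g [/int_qseries_coef[a ha] hg]] : exists g, int_qseries g /\
    forall tau, upper_half_plane tau -> psi j.-1 tau = g (e2pi tau).
  by apply: hpsi; rewrite prednK.
(* Takes back the 1 / 4 inside [psi 0]. It changes the constant coefficient for j = 1 only, which is
   the excepted pair. *)
pose b n : C R := ((j == 1%N) && (n == 0%N))%:R / 4.
exists (fun n => (a n)%:~R - b n); last first.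
  move=> n jn; exists (a n); rewrite /b; case: eqP => [j1|_]; last by rewrite mul0r subr0.
  case: eqP => [n0|_]; last by rewrite mul0r subr0.
  by case: jn; rewrite j1 n0.
move=> tau htau; have q1 := nm_e2pi htau.
have -> : f j tau + ratr (bernoulli j) / (2 * j)%N%:R = g (e2pi tau) - (j == 1%N)%:R / 4.
  by rewrite -hg// /psi prednK// -subn1 -[X in X == 1%N](subnK hj) addn1 eqSS addrK.
have /cvg_nmP h := ha _ q1; apply/cvg_nmP => e /h[n0 hn0].
exists n0.+1 => n hn; have {hn0} := hn0 n (ltnW hn).
have hb : \sum_(0 <= i < n) b i * e2pi tau ^+ i = (j == 1%N)%:R / 4.
  case: n hn => // n _; rewrite big_nat_recl//= expr0 mulr1 /b eqxx andbT big1 ?addr0//.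
  by move=> i _; rewrite andbF mul0r mul0r.
have -> : series (fun n => ((a n)%:~R - b n) * e2pi tau ^+ n) n =
    series (fun n => (a n)%:~R * e2pi tau ^+ n) n - (j == 1%N)%:R / 4.
  by rewrite /series /= -hb -sumrB; apply: eq_bigr => i _; rewrite mulrBl.
by congr (nm _ < e); ring.
Qed.
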